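(* Consider the nonlinear impulsive system (with constants $a,c,l>0$, $\delta\in\mathbb R$) $$\partial_t x(z,t)=a^2\partial_{zz}x(z,t)+\Phi(x(z,t))+B(z)y(t)+d_{11}(z,t),\quad t\ne\tau_k,$$ $$\dot y(t)=c^2y(t)+\int_0^lD(z)x(z,t)\,dz+d_{12}(t),\quad t\neq\tau_k,$$ $$x(z,t^+)=\alpha(z)x(z,t)+\beta(z)y(t)+d_{21}(z,k),\quad t=\tau_k,$$ $$y(t^+)=\int_0^l\gamma(z)x(z,t)\,dz+\delta y(t)+d_{22}(k),\quad t=\tau_k,$$ with boundary conditions $x(0,t)=x(l,t)=0$ and initial data in $H_0^1(0,l)\times\mathbb R$, where $\alpha\in C^2[0,l]$, $\beta,B\in H_0^1(0,l)$, $\gamma,D\in L^2[0,l]$, and $\Phi:\mathbb R\to\mathbb R$ is $C^1$ with locally Lipschitz derivative, $\Phi'(s)\le0$ and $s\Phi(s)\le0$ for all $s\in\mathbb R$. Let $A_0,B_0,\sigma,\vartheta$ be as defined in the context, and let $\varrho^{A_0}_{\max},\varrho^{B_0}_{\max}\in\mathbb R^2$ be eigenvectors of $A_0$ and $B_0$ for the maximal eigenvalues $\lambda_{\max}(A_0)$ and $\lambda_{\max}(B_0)$, respectively. Assume $$c^2+\frac{\pi^2a^2}{l^2}>\frac l\pi\|D\|_{L^2[0,l]}+\|B\|_{H_0^1(0,l)},\qquad \vartheta>0,\qquad (\varrho_{\max}^{A_0})^{T}\operatorname{diag}\{-1,1\}\varrho_{\max}^{A_0}>0,$$ and additionally that one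 of the following two conditions holds: (a) $(\varrho_{\max}^{B_0})^{T}\operatorname{diag}\{-1,1\}\varrho_{\max}^{B_0}\ge0$, and $\theta_1,\theta_2$ satisfy $$\frac1\vartheta\ln\frac\sigma2<\theta_1\le\theta_2<-\frac{1}{\lambda_{\max}(A_0)}\ln\lambda_{\max}(B_0);$$ (b) $(\varrho_{\max}^{B_0})^{T}\operatorname{diag}\{-1,1\}\varrho_{\max}^{B_0}<0$, and $\theta_1,\theta_2$ satisfy $$\frac1\vartheta\ln\lambda_{\max}(B_0)<\theta_1\le\theta_2<\frac{1}{\lambda_{\max}(A_0)}\ln\frac2\sigma.$$ Then the system is ISS for all impulse time sequences $\mathcal E=\{\tau_k\}_{k=0}^\infty$ satisfying the dwell-time condition $\theta_1\le T_k=\tau_{k+1}-\tau_k\le\theta_2$, $k\in\mathbb Z_+$.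
   Context: Norms: $\|f\|_{H_0^1(0,l)}=\|\partial_zf\|_{L^2[0,l]}$, $\|f\|_{C[0,l]}=\max_{[0,l]}|f|$. State space $X=H_0^1(0,l)\times\mathbb R$ with $\|(x,y)\|_X=(\|x\|_{H_0^1(0,l)}^2+y^2)^{1/2}$; input value spaces $U_1=U_2=H_0^1(0,l)\times\mathbb R$ with the same norm. Input signal spaces: $\mathcal U_1$ consists of bounded functions $d_1=(d_{11},d_{12}):\mathbb R_+\to U_1$ such that $d_{11}:\mathbb R_+\to H_0^1(0,l)$ and $d_{12}:\mathbb R_+\to\mathbb R$ are each locally Hölder continuous (with some exponent in $(0,1]$), with $\|d_1\|_{\mathcal U_1}=\sup_t\|d_1(t)\|_{U_1}$; $\mathcal U_2=l^\infty(\mathbb Z_+,U_2)$, $d_2(k)=(d_{21}(\cdot,k),d_{22}(k))$, with the supremum norm. Impulse times $\mathcal E=\{\tau_k\}_{k=0}^\infty$ are strictly increasing with $\tau_k\to\infty$. Solutions: between impulses solutions are classical solutions in the sense of Henry of the abstract semilinear parabolic equation on $\hat X=L^2[0,l]\times\mathbb R$ (continuous with values in $X$ up to the initial time, with values in $(H^2(0,l)\cap H_0^1(0,l))\times\mathbb R$ and differentiable in $\hat X$ afterwards); solutions are left-continuous at impulse times, and at each $\tau_k\ge t_0$ the state jumps according to the given jump relations, from which the continuous evolution restarts. Let $\phi(t,t_0,x_0,d_1,d_2)\in X$ denote the solution with state $x_0\in X$ at time $t_0\ge 0$. $\mathcal K_\infty$: continuous strictly increasing unbounded functions $\mathbb R_+\to\mathbb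 R_+$ vanishing exactly at $0$; $\mathcal{KL}$: continuous $\beta:\mathbb R_+\times\mathbb R_+\to\mathbb R_+$ with $\beta(\cdot,t)$ strictly increasing and vanishing exactly at $0$, and $\beta(s,\cdot)$ decreasing to $0$. The system is ISS (for a fixed $\mathcal E$) if for every $t_0$ there are $\beta_{t_0}\in\mathcal{KL}$, $\gamma_{t_0}\in\mathcal K_\infty$ with $\|\phi(t,t_0,x_0,d_1,d_2)\|_X\le\beta_{t_0}(\|x_0\|_X,t)+\gamma_{t_0}(\max\{\|d_1\|_{\mathcal U_1},\|d_2\|_{\mathcal U_2}\})$ for all $t\ge t_0$, $x_0\in X$, $(d_1,d_2)\in\mathcal U_1\times\mathcal U_2$. Constants and symmetric matrices (subscripts $z$ denote derivatives): $$A_0=\begin{pmatrix}-\frac{2\pi^2a^2}{l^2}&\|B\|_{H_0^1(0,l)}+\frac l\pi\|D\|_{L^2[0,l]}\\ \|B\|_{H_0^1(0,l)}+\frac l\pi\|D\|_{L^2[0,l]}&2c^2\end{pmatrix},\qquad B_0=\begin{pmatrix}b_{11}&b_{12}\\ b_{12}&b_{22}\end{pmatrix},$$ $$b_{11}=\|\alpha^2\|_{C[0,l]}+\frac{l^2}{\pi^2}\|\alpha\alpha_{zz}\|_{C[0,l]}+\frac{l^2}{\pi^2}\|\gamma\|_{L^2[0,l]}^2,$$ $$b_{12}=\frac l\pi\|\alpha_z\beta_z+\gamma\delta\|_{L^2[0,l]}+\|\alpha\beta_z\|_{L^2[0,l]},\qquad b_{22}=\delta^2+\|\beta\|^2_{H_0^1(0,l)},$$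 $$\sigma=b_{11}+2b_{12}+b_{22},\qquad \vartheta=\frac{\pi^2a^2}{l^2}-\|B\|_{H_0^1(0,l)}-\frac l\pi\|D\|_{L^2[0,l]}-c^2.$$ *)

(* Defs.v *)
(* Functions on [0, l] are represented by total functions [R -> R]; only their
   values on [0, l] matter in every notion below.  An element of L^2[0, l] is
   given by one of its Borel representatives; an element of H^1(0, l) is given
   by its continuous representative. *)
From HB Require Import structures.
From mathcomp Require Import all_boot all_order all_algebra.
From mathcomp Require Import all_classical all_reals all_analysis.
Set Implicit Arguments.
Unset Strict Implicit.
Unset Printing Implicit Defensive.
Import Order.TTheory GRing.Theory Num.Theory.
Import numFieldNormedType.Exports.
Local Open Scope classical_set_scope.
Local Open Scope ring_scope.

Section FunctionSpaces.
Context {R : realType}.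
Notation mu := (@lebesgue_measure R).
Variable l : R.
Implicit Types f g h : R -> R.

Definition L2 f : Prop := (f \_ `[0, l]) \in Lfun mu 2%:E.

Definition L2norm f : R := fine (Lnorm mu 2%:E (EFin \o (f \_ `[0, l]))).

(* The max over [0, l] for continuous f. *)
Definition Cnorm f : R := sup [set `|f z| | z in `[0, l]].

(* g is an L^2 weak derivative of f: in dimension one, f is then the absolutely
   continuous primitive of g. *)
Definition is_wderiv f g : Prop :=
  L2 g /\ forall z, z \in `[0, l] -> f z = f 0 + \int[mu]_(w in `[0, z]) g w.

(* A representative of the weak derivative; it is unique up to null sets, so
   that norms of expressions in [wderiv f] do not depend on the choice. *)
Definition wderiv f : R -> R := xget 0 [set g | is_wderiv f g].

Definition H01 f : Prop := (exists g, is_wderiv f g) /\ f 0 = 0 /\ f l = 0.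

Definition H01norm f : R := L2norm (wderiv f).

(* The intermediate g is the continuous representative of the derivative, hence
   in general not [wderiv f]. *)
Definition is_wderiv2 f h : Prop :=
  exists2 g, is_wderiv f g & is_wderiv g h.

Definition H2 f : Prop := exists h, is_wderiv2 f h.

Definition wderiv2 f : R -> R := xget 0 [set h | is_wderiv2 f h].

(* f is in C^1[0, l] with derivative f' (one-sided at the endpoints). *)
Definition is_C1 f f' : Prop :=
  [/\ {within `[0, l], continuous f}, {within `[0, l], continuous f'} &
      forall z, z \in `]0, l[ -> is_derive z 1 f (f' z)].

Definition is_C2 f f' f'' : Prop := is_C1 f f' /\ is_C1 f' f''.

End FunctionSpaces.

Section ImpulsiveSystems.
Context {R : realType}.

Definition state : Type := ((R -> R) * R)%type.

Variable l : R.

Definition inX (x : state) : Prop := H01 l x.1.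

Definition normX (x : state) : R :=
  Num.sqrt (H01norm l x.1 ^+ 2 + x.2 ^+ 2).

(* The norm of L^2[0, l] x R. *)
Definition normXhat (x : state) : R :=
  Num.sqrt (L2norm l x.1 ^+ 2 + x.2 ^+ 2).

(* One exponent for the whole half-line, local constants. *)
Definition locally_holder (V : zmodType) (nrm : V -> R) (f : R -> V) : Prop :=
  exists2 p : R, 0 < p <= 1 &
    forall t, 0 <= t -> exists2 r : R, 0 < r & exists C : R,
      forall s1 s2, 0 <= s1 -> 0 <= s2 -> `|s1 - t| < r -> `|s2 - t| < r ->
        nrm (f s1 - f s2) <= C * `|s1 - s2| `^ p.

Definition inU1 (d : R -> state) : Prop :=
  [/\ forall t, 0 <= t -> inX (d t),
      has_ubound [set normX (d t) | t in `[0, +oo[],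
      locally_holder (H01norm l) (fun t => (d t).1) &
      locally_holder (fun y : R => `|y|) (fun t => (d t).2)].

Definition normU1 (d : R -> state) : R := sup [set normX (d t) | t in `[0, +oo[].

Definition inU2 (d : nat -> state) : Prop :=
  (forall k, inX (d k)) /\ has_ubound (range (fun k => normX (d k))).

Definition normU2 (d : nat -> state) : R := sup (range (fun k => normX (d k))).

Definition impulse_times (tau : nat -> R) : Prop :=
  (forall k, tau k < tau k.+1) /\ tau @ \oo --> +oo.

(* [phi] is a solution on [t0, T) with state [x0] at time [t0] of the impulsive
   system with flow right-hand side [F d x] (input value d, state x) and jump
   map [G d x].  The value [phi (tau k)] is the state just before the jump: at
   t0 = tau k the jump acts on x0.  T = +oo is the case of a global solution. *)
Definition is_solution (F G : state -> state -> state) (tau : nat -> R)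
    (d1 : R -> state) (d2 : nat -> state)
    (t0 : R) (x0 : state) (T : \bar R) (phi : R -> state) : Prop :=
  [/\ phi t0 = x0 /\
        (forall t, t0 <= t -> (t%:E < T)%E -> inX (phi t)),
      (forall t, t0 < t -> (t%:E < T)%E ->
        normX (phi s - phi t) @[s --> t^'-] --> 0),
      (forall t, t0 <= t -> (t%:E < T)%E -> ~ range tau t ->
        normX (phi s - phi t) @[s --> t^'+] --> 0),
      (forall k, t0 <= tau k -> ((tau k)%:E < T)%E ->
        normX (phi s - G (d2 k) (phi (tau k))) @[s --> (tau k)^'+] --> 0) &
      (forall t, t0 < t -> (t%:E < T)%E -> ~ range tau t ->
        H2 l (phi t).1 /\
        normXhat (h^-1 *: (phi (t + h) - phi t) - F (d1 t) (phi t))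
          @[h --> 0^'] --> 0)].

Definition class_Koo (g : R -> R) : Prop :=
  [/\ {within `[0, +oo[, continuous g},
      {in Num.nneg &, {homo g : s r / s < r}},
      g 0 = 0 &
      forall M, exists2 s, 0 <= s & M < g s].

Definition class_KL (b : R -> R -> R) : Prop :=
  [/\ {within `[0, +oo[ `*` `[0, +oo[, continuous (fun p : R * R => b p.1 p.2)},
      forall t, 0 <= t -> {in Num.nneg &, {homo b^~ t : s r / s < r}},
      forall t, 0 <= t -> b 0 t = 0,
      forall s, 0 < s -> {in Num.nneg &, {homo b s : t r / t < r >-> r < t}} &
      forall s, 0 <= s -> b s t @[t --> +oo] --> 0].

(* The estimate is required of every solution on its interval of existence,
   global or not. *)
Definition ISS (F G : state -> state -> state) (tau : nat -> R) : Prop :=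
  forall t0, 0 <= t0 ->
  exists b : R -> R -> R, exists g : R -> R,
    [/\ class_KL b, class_Koo g &
        forall x0 d1 d2 T phi,
          inX x0 -> inU1 d1 -> inU2 d2 ->
          is_solution F G tau d1 d2 t0 x0 T phi ->
          forall t, t0 <= t -> (t%:E < T)%E ->
            normX (phi t) <= b (normX x0) t + g (Num.max (normU1 d1) (normU2 d2))].

End ImpulsiveSystems.

Section HeatOde.
Context {R : realType}.
Notation mu := (@lebesgue_measure R).
Variables l a c delta : R.
Variable Phi : R -> R.
(* [alpha_z], [alpha_zz] are the first and second derivatives of [alpha]. *)
Variables alpha alpha_z alpha_zz beta gamma B D : R -> R.

Definition flow_rhs (d x : @state R) : state :=
  (fun z => a ^+ 2 * wderiv2 l x.1 z + Phi (x.1 z) + B z * x.2 + d.1 z,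
   c ^+ 2 * x.2 + \int[mu]_(z in `[0, l]) (D z * x.1 z) + d.2).

Definition jump_map (d x : @state R) : state :=
  (fun z => alpha z * x.1 z + beta z * x.2 + d.1 z,
   \int[mu]_(z in `[0, l]) (gamma z * x.1 z) + delta * x.2 + d.2).

Definition sym2 (p q r : R) : 'M[R]_2 :=
  \matrix_(i, j) if i != j then q else if i == 0 then p else r.

Definition A0 : 'M[R]_2 :=
  sym2 (- (2 * pi ^+ 2 * a ^+ 2 / l ^+ 2))
       (H01norm l B + l / pi * L2norm l D)
       (2 * c ^+ 2).

Definition b11 : R :=
  Cnorm l (fun z => alpha z ^+ 2)
  + l ^+ 2 / pi ^+ 2 * Cnorm l (fun z => alpha z * alpha_zz z)
  + l ^+ 2 / pi ^+ 2 * L2norm l gamma ^+ 2.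

Definition b12 : R :=
  l / pi * L2norm l (fun z => alpha_z z * wderiv l beta z + gamma z * delta)
  + L2norm l (fun z => alpha z * wderiv l beta z).

Definition b22 : R := delta ^+ 2 + H01norm l beta ^+ 2.

Definition B0 : 'M[R]_2 := sym2 b11 b12 b22.

Definition sigma : R := b11 + 2 * b12 + b22.

Definition vartheta : R :=
  pi ^+ 2 * a ^+ 2 / l ^+ 2 - H01norm l B - l / pi * L2norm l D - c ^+ 2.

(* For the symmetric matrices considered here the supremum is a maximum. *)
Definition lambda_max (M : 'M[R]_2) : R := sup [set x | eigenvalue M x].

Definition max_eigenvector (M : 'M[R]_2) (v : 'cV[R]_2) : Prop :=
  v != 0 /\ M *m v = lambda_max M *: v.

(* v^T diag{-1, 1} v *)
Definition cone_form (v : 'cV[R]_2) : R :=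
  (v^T *m sym2 (-1) 0 1 *m v) 0 0.

End HeatOde.

(* Main.v *)
Require Import Defs.
From mathcomp Require Import all_boot all_order all_algebra.
From mathcomp Require Import all_classical all_reals all_analysis.
From mathcomp Require Import measurable_realfun ring lra.
Import Order.TTheory GRing.Theory Num.Theory.
Import numFieldNormedType.Exports.
Local Open Scope classical_set_scope.
Local Open Scope ring_scope.

(* Write p = |x_z|, q = |y|, V = p^2 + q^2 for the two parts of the X-norm.
   Along the flow V' <= w^T A_0 w + 2 e (p + q) with w = (p, q), where e bounds
   the inputs; hence V grows at rate at most lambda_max(A_0), and decays at rate
   vartheta while q <= p.  The assumption on c^2 + pi^2 a^2 / l^2 makes the cone
   q > p forward invariant as long as V is large compared with e^2.  So on each
   flow interval either V falls below a multiple of e^2, or q < p at the end and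
   q <= p held all along, or q >= p at the end; the jump then multiplies V by at
   most sigma / 2 or lambda_max(B_0), according to the final cone and to the sign
   of the cone form at the eigenvector of B_0.  In each case the dwell-time
   condition makes the product of the flow factor and the jump factor less
   than 1, which gives V(tau_{k+1}^+) <= kappa V(tau_k^+) + C e^2 with kappa < 1.

   Only the left upper Dini derivative of p^2 is estimated: solutions are merely
   differentiable with values in L^2, so p^2 need not be differentiable.  The
   calculus of absolutely continuous functions rests on one remark: a function D
   with |D(b) - D(a)| <= (b - a) (M(b) - M(a)) is constant. *)

Set Implicit Arguments.
Unset Strict Implicit.
Unset Printing Implicit Defensive.

(** * Square-integrable functions on [0, l] *)

Section L2space.
Context {R : realType}.
Context (l : R).
Notation mu := (@lebesgue_measure R).
Implicit Types f g h : R -> R.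

(** The strict inequalities of the theorem leave room for one slack eps, spent on the inputs. Above
    the threshold V > 8 e^2 / eps^2 the input terms add at most eps to the rate of V; eps stays
    below the margin of the cone inequality, so the cone remains invariant; and by Young's
    inequality a jump costs only an extra factor 1 + eps and a multiple of e^2. The lower dwell
    bound serves the case q < p, where V decays and a long interval helps; the upper one serves the
    case of growth, where a long interval hurts.

    The number sigma / 2 is the value of the form of B_0 at the unit vector on p = q, the common
    boundary of the two cones. It bounds the form on the cone that gives more weight to the smaller
    diagonal entry of B_0, and the sign of the cone form at the eigenvector tells which entry that
    is. On the other cone lambda_max(B_0) is used.

    The reaction term leaves no constant behind: after integration by parts its contribution to the
    derivative of p^2 has a favourable sign. *)

Definition intble f := mu.-integrable `[0, l] (EFin \o f).

Definition ip f g : R := \int[mu]_(z in `[0, l]) (f z * g z).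

Lemma intbleD f g : intble f -> intble g -> intble (fun z => f z + g z).
Proof. by move=> fi gi; apply: (integrableD _ fi gi). Qed.

Lemma intbleZ c f : intble f -> intble (fun z => c * f z).
Proof. by move=> fi; apply: (integrableZl _ c fi). Qed.

(** [L2] speaks of the extension by zero to the whole line; this form lives on [0, l] alone, and
    sums and products are checked through it. *)
Lemma L2P f : L2 l f <->
  measurable_fun `[0, l] f /\ intble (fun z => f z ^+ 2).
Proof.
have mI : measurable (`[0, l]%classic : set R) by [].
have restr_sqr : (fun x => (f \_ `[0, l]) x ^+ 2) = (fun x => f x ^+ 2) \_ `[0, l].
  apply/funext => x; rewrite /patch; case: ifP => // _; exact: expr0n.
split => [fL|[mf fi]].
  split.
    by move: fL; rewrite /L2 inE => /andP[]; rewrite inE/= => /(measurable_restrictT _ mI).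
  have := Lfun2_integrable_sqr fL.
  rewrite restr_sqr -restrict_EFin => /integrable_restrict.
  by rewrite setTI; apply.
have mf' : measurable_fun [set: R] (f \_ `[0, l]) by apply: (measurable_restrictT f mI).1.
rewrite /L2 inE; apply/andP; split; rewrite inE//= /finite_norm unlock /=.
rewrite poweR_lty//.
under eq_integral do rewrite /= powR_mulrn// -normrX ger0_norm ?sqr_ge0//.
have : mu.-integrable setT (EFin \o (fun x => (f \_ `[0, l]) x ^+ 2)).
  by rewrite restr_sqr -restrict_EFin; apply/integrable_restrict => //; rewrite setTI.
exact: integrable_lty.
Qed.

(** No integrability is assumed: if the square has infinite integral, [fine] turns both sides into
    0. *)
Lemma L2normE f : L2norm l f = Num.sqrt (ip f f).
Proof.
rewrite /L2norm unlock /=.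
have -> : (\int[mu]_x ((`|(f \_ `[0%R, l]) x| `^ 2)%:E) = \int[mu]_(x in `[0%R,
  l]) ((f x * f x)%:E))%E.
  rewrite [RHS]integral_mkcond; apply: eq_integral => x _ /=.
  rewrite restrict_EFin /= powR_mulrn// -normrX ger0_norm ?sqr_ge0//.
  by rewrite /patch; case: ifP => // _; rewrite expr2 ?mulr0.
have ge0 : (0 <= \int[mu]_(x in `[0%R, l]) ((f x * f x)%:E))%E.
  by apply: integral_ge0 => x _; rewrite lee_fin -expr2 sqr_ge0.
rewrite /ip /Rintegral; case: (integral _ _ _) ge0 => [r|_|//]; last first.
  by rewrite poweRyr ?invr_eq0 ?pnatr_eq0//= sqrtr0.
by rewrite lee_fin => r0; rewrite poweR_EFin/= powR12_sqrt.
Qed.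

Lemma L2norm_ge0 f : 0 <= L2norm l f.
Proof. by rewrite L2normE sqrtr_ge0. Qed.

Lemma ip_ge0 f : 0 <= ip f f.
Proof. by apply: Rintegral_ge0 => x _; rewrite -expr2 sqr_ge0. Qed.

Lemma L2norm_sqr f : L2norm l f ^+ 2 = ip f f.
Proof. by rewrite L2normE sqr_sqrtr// ip_ge0. Qed.

Lemma eq_L2 f g : {in `[0, l]%classic, f =1 g} -> L2 l f -> L2 l g.
Proof.
move=> fg; rewrite /L2; suff -> : f \_ `[0, l] = g \_ `[0, l] by [].
by apply/funext => z; rewrite /patch; case: ifP => // /fg.
Qed.

Lemma eq_L2norm f g : {in `[0, l]%classic, f =1 g} -> L2norm l f = L2norm l g.
Proof. by move=> fg; rewrite !L2normE /ip; congr Num.sqrt; apply: eq_Rintegral => z zI;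
  rewrite !fg. Qed.

Lemma L2_mul_int f g : L2 l f -> L2 l g -> intble (fun z => f z * g z).
Proof.
move=> /L2P[mf fi] /L2P[mg gi].
apply: (@le_integrable _ _ _ mu `[0, l] _ _ (EFin \o (fun z => f z ^+ 2 + g z ^+ 2))) => //.
- by apply/measurable_EFinP; exact: measurable_funM.
- move=> x _ /=; rewrite lee_fin [leRHS]ger0_norm ?addr_ge0 ?sqr_ge0//.
  by rewrite normrM -(real_normK (num_real (f x))) -(real_normK (num_real (g x))); nra.
- exact: (intbleD fi gi).
Qed.

Lemma within_contM f g (A : set R) : {within A, continuous f} ->
  {within A, continuous g} -> {within A, continuous (fun z => f z * g z)}.
Proof. by move=> cf cg x; apply: cvgM; [exact: cf|exact: cg]. Qed.

Lemma L2_cont f : {within `[0, l], continuous f} -> L2 l f.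
Proof.
move=> cf; apply/L2P; split; first exact: subspace_continuous_measurable_fun.
apply: continuous_compact_integrable; first exact: segment_compact.
exact: (within_contM cf cf).
Qed.

Lemma L2_cst c : L2 l (fun=> c).
Proof. by apply: L2_cont => x; apply: cvg_cst. Qed.

Lemma L2_int f : L2 l f -> intble f.
Proof.
move=> /L2_mul_int /(_ (L2_cst 1)).
by apply: eq_integrable => // x _ /=; rewrite mulr1.
Qed.

Lemma L2D f g : L2 l f -> L2 l g -> L2 l (fun z => f z + g z).
Proof.
move=> fL gL; have fgi := L2_mul_int fL gL.
move: fL gL => /L2P[mf fi] /L2P[mg gi]; apply/L2P; split.
  exact: measurable_funD.
have /= := intbleD (intbleD fi gi) (intbleZ 2 fgi).
by apply: eq_integrable => // x _ /=; congr EFin; ring.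
Qed.


Lemma within_cont_bounded f : {within `[0, l], continuous f} ->
  exists2 M : R, 0 <= M & forall z : R, z \in `[0, l] -> `|f z| <= M.
Proof.
move=> cf; have [M [_ mrt]] := compact_bounded (continuous_compact cf (@segment_compact _ 0 l)).
exists (Num.max M 0 + 1) => [|z zI]; first by rewrite addr_ge0// le_max lexx orbT.
by apply: mrt; [rewrite ltr_pwDr// le_max lexx|exists z].
Qed.

Lemma L2M f g : {within `[0, l], continuous f} -> L2 l g -> L2 l (fun z => f z * g z).
Proof.
move=> cf /L2P[mg gi].
have mf : measurable_fun `[0, l] f by exact: subspace_continuous_measurable_fun.
have [M M0 fM] := within_cont_bounded cf.
apply/L2P; split; first exact: measurable_funM.
apply: (@le_integrable _ _ _ mu `[0, l] _ _ (EFin \o (fun z => M ^+ 2 * g z ^+ 2))) => //.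
- by apply/measurable_EFinP; apply: measurable_funX; exact: measurable_funM.
- move=> x xI /=; rewrite lee_fin exprMn.
  rewrite !(ger0_norm (mulr_ge0 (sqr_ge0 _) (sqr_ge0 _))).
  rewrite ler_wpM2r ?sqr_ge0// -(real_normK (num_real (f x))).
  by rewrite ler_pXn2r ?nnegrE//; exact: fM.
- exact: (intbleZ _ gi).
Qed.

Lemma L2Z c f : L2 l f -> L2 l (fun z => c * f z).
Proof. by apply: L2M => x; apply: cvg_cst. Qed.

Lemma L2N f : L2 l f -> L2 l (fun z => - f z).
Proof. by move=> /(L2Z (-1)); apply: eq_L2 => z _; rewrite mulN1r. Qed.

Lemma L2B f g : L2 l f -> L2 l g -> L2 l (fun z => f z - g z).
Proof. by move=> fL /L2N; exact: L2D. Qed.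

Lemma ipC f g : ip f g = ip g f.
Proof. by apply: eq_Rintegral => z _; rewrite mulrC. Qed.

Lemma eq_ipl f g h : {in `[0, l]%classic, f =1 g} -> ip f h = ip g h.
Proof. by move=> fg; apply: eq_Rintegral => z zI; rewrite fg. Qed.

Lemma ipDl f g h : L2 l f -> L2 l g -> L2 l h ->
  ip (fun z => f z + g z) h = ip f h + ip g h.
Proof.
move=> fL gL hL; rewrite -RintegralD//; try exact: L2_mul_int.
by apply: eq_Rintegral => z _; rewrite mulrDl.
Qed.

Lemma ipZl c f h : L2 l f -> L2 l h -> ip (fun z => c * f z) h = c * ip f h.
Proof.
move=> fL hL; rewrite -RintegralZl//; last exact: L2_mul_int.
by apply: eq_Rintegral => z _; rewrite mulrA.
Qed.

Lemma ipNl f h : L2 l f -> L2 l h -> ip (fun z => - f z) h = - ip f h.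
Proof.
move=> fL hL; rewrite -mulN1r -ipZl//.
by apply: eq_ipl => z _; rewrite mulN1r.
Qed.

Lemma ipBl f g h : L2 l f -> L2 l g -> L2 l h ->
  ip (fun z => f z - g z) h = ip f h - ip g h.
Proof. by move=> fL gL hL; rewrite ipDl ?ipNl//; exact: L2N. Qed.

Lemma ip_sqrD f g : L2 l f -> L2 l g ->
  ip (fun z => f z + g z) (fun z => f z + g z) = ip f f + 2 * ip f g + ip g g.
Proof.
move=> fL gL; rewrite ipDl//; last exact: L2D.
rewrite ![ip _ (fun z => _ + _)]ipC !ipDl// (ipC g f); ring.
Qed.

Lemma ip_sqrZ c f : L2 l f -> ip (fun z => c * f z) (fun z => c * f z) = c ^+ 2 * ip f f.
Proof.
move=> fL; rewrite ipZl//; last exact: L2Z.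
by rewrite ipC ipZl// mulrA.
Qed.

Lemma cauchy_schwarz f g : L2 l f -> L2 l g -> `|ip f g| <= L2norm l f * L2norm l g.
Proof.
move=> fL gL; rewrite -(@ler_pXn2r _ 2)// ?nnegrE ?mulr_ge0 ?L2norm_ge0//.
rewrite exprMn !L2norm_sqr real_normK ?num_real//.
have pos c : 0 <= ip f f * c ^+ 2 + 2 * c * ip f g + ip g g.
  have := ip_ge0 (fun z => c * f z + g z).
  by rewrite ip_sqrD ?ip_sqrZ ?ipZl//; [lra|exact: L2Z].
have := ip_ge0 f; rewrite le_eqVlt => /predU1P[f0|f0].
  have [->|fg0] := eqVneq (ip f g) 0; first by rewrite expr0n/= mulr_ge0 ?ip_ge0.
  (* When [ip f f] vanishes the quadratic is affine in [c], and this [c] would give it the value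
     -1. *)
  have := pos (- (ip g g + 1) / (2 * ip f g)).
  rewrite -f0 mul0r add0r.
  have -> : 2 * (- (ip g g + 1) / (2 * ip f g)) * ip f g = - (ip g g + 1) by field.
  lra.
have := pos (- ip f g / ip f f).
have -> : ip f f * (- ip f g / ip f f) ^+ 2 + 2 * (- ip f g / ip f f) * ip f g
   = - (ip f g ^+ 2 / ip f f) by field; rewrite gt_eqF.
rewrite addrC subr_ge0 ler_pdivrMr// mulrC//.
Qed.

Lemma L2norm_triangle f g : L2 l f -> L2 l g ->
  L2norm l (fun z => f z + g z) <= L2norm l f + L2norm l g.
Proof.
move=> fL gL; rewrite -(@ler_pXn2r _ 2)// ?nnegrE ?addr_ge0 ?L2norm_ge0//.
rewrite L2norm_sqr ip_sqrD// sqrrD !L2norm_sqr.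
have := le_trans (ler_norm _) (cauchy_schwarz fL gL); lra.
Qed.

Lemma L2normZ c f : L2 l f -> L2norm l (fun z => c * f z) = `|c| * L2norm l f.
Proof. by move=> fL; rewrite !L2normE ip_sqrZ// sqrtrM ?sqr_ge0// sqrtr_sqr. Qed.

End L2space.

(** * Weak derivatives *)

Section WeakDerivative.
Context {R : realType}.
Context (l : R).
Notation mu := (@lebesgue_measure R).
Implicit Types f g h : R -> R.

Lemma intble_sub f a b : 0 <= a -> b <= l -> intble l f ->
  mu.-integrable `[a, b] (EFin \o f).
Proof.
move=> a0 bl; apply: integrableS => // z /=; rewrite !in_itv/= => /andP[az zb].
by rewrite (le_trans a0 az) (le_trans zb bl).
Qed.

Lemma Rintegral_sub f a b : 0 <= a -> a <= b -> b <= l -> intble l f ->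
  \int[mu]_(w in `[0, b]) f w - \int[mu]_(w in `[0, a]) f w =
  \int[mu]_(w in `[a, b]) f w.
Proof.
move=> a0 ab bl fi.
rewrite Rintegral_itvB ?bnd_simp//; last exact: intble_sub fi.
rewrite Rintegral_itv_obnd_cbnd//.
apply: integrableS (intble_sub a0 bl fi) => //.
by apply: subset_itvr; rewrite bnd_simp.
Qed.

(** Cauchy-Schwarz against the constant 1 on a subinterval, obtained by integrating (|g| - t)^2 >= 0
    with [t] the mean of |g|. *)
Lemma Rintegral_abs_sqr g a b : 0 <= a -> a <= b -> b <= l -> L2 l g ->
  (\int[mu]_(w in `[a, b]) `|g w|) ^+ 2 <= (b - a) * \int[mu]_(w in `[a, b]) (g w ^+ 2).
Proof.
move=> a0 ab bl gL.
have gi := intble_sub a0 bl (L2_int gL).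
have [_ g2i'] := (L2P _ _).1 gL; have g2i := intble_sub a0 bl g2i'.
have [ab0|ab0] := eqVneq a b.
  by rewrite ab0 subrr mul0r set_itv1 Rintegral_set1 expr0n.
have ba : 0 < b - a by rewrite subr_gt0 lt_neqAle ab0.
have agi : mu.-integrable `[a, b] (EFin \o (fun w => `|g w|)) := integrable_norm gi.
set G := Rintegral _ _ _.
pose t := G / (b - a).
have : 0 <= \int[mu]_(w in `[a, b]) (g w ^+ 2 - (2 * t * `|g w| - t ^+ 2)).
  apply: Rintegral_ge0 => w _.
  by rewrite -(real_normK (num_real (g w))); have := sqr_ge0 (`|g w| - t); nra.
have ci : mu.-integrable `[a, b] (EFin \o (fun=> t ^+ 2)).
  apply: continuous_compact_integrable; first exact: segment_compact.
  by move=> x; apply: cvg_cst.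
have tgi : mu.-integrable `[a, b] (EFin \o (fun w => 2 * t * `|g w|)).
  exact: (integrableZl _ _ agi).
rewrite RintegralB//; last exact: (integrableB _ tgi ci).
rewrite RintegralB// RintegralZl// Rintegral_cst//= lebesgue_measure_itv/= lte_fin -subr_gt0 ba -EFinB/= -/G.
have -> : 2 * t * G - t ^+ 2 * (b - a) = G ^+ 2 / (b - a) by rewrite /t; field; rewrite gt_eqF.
by rewrite subr_ge0 ler_pdivrMr// mulrC.
Qed.

(** On the uniform partition of [0, z] into n pieces the bounds telescope to (z / n) (M z - M 0),
    and n is arbitrary. *)
Lemma quadratic_variation_const (Del M : R -> R) (z : R) : 0 <= z ->
  (forall a b : R, 0 <= a -> a <= b -> b <= z ->
    `|Del b - Del a| <= (b - a) * (M b - M a)) -> Del z = Del 0.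
Proof.
move=> z0 H.
have step n i : (i <= n.+1)%N ->
    `|Del (z / n.+1%:R * i%:R) - Del 0| <= z / n.+1%:R * (M (z / n.+1%:R * i%:R) - M 0).
  have s0 : 0 <= z / n.+1%:R by rewrite divr_ge0.
  elim: i => [_|i IH iN]; first by rewrite mulr0 !subrr normr0 mulr0.
  have := IH (ltnW iN).
  have := H (z / n.+1%:R * i%:R) (z / n.+1%:R * i.+1%:R).
  rewrite mulr_ge0// ler_wpM2l ?ler_nat// => /(_ isT isT).
  have -> : z / n.+1%:R * i.+1%:R <= z.
    by rewrite mulrAC ler_pdivrMr ?ltr0n// ler_wpM2l// ler_nat.
  move=> /(_ isT).
  have -> : z / n.+1%:R * i.+1%:R - z / n.+1%:R * i%:R = z / n.+1%:R.
    by rewrite -mulrBr -natrB// subSnn mulr1.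
  set d := z / n.+1%:R => H1 H2.
  have -> : Del (d * i.+1%:R) - Del 0 =
    (Del (d * i.+1%:R) - Del (d * i%:R)) + (Del (d * i%:R) - Del 0) by ring.
  by apply: (le_trans (ler_normD _ _)); apply: (le_trans (lerD H1 H2)); rewrite -mulrDr; lra.
have bnd n : `|Del z - Del 0| * n.+1%:R <= z * (M z - M 0).
  have := step n n.+1 (leqnn _).
  by rewrite divfK ?pnatr_eq0// mulrAC -ler_pdivlMr ?ltr0n.
apply/eqP; rewrite -subr_eq0 -normr_eq0; apply/negP => /negP D0.
have Dp : 0 < `|Del z - Del 0| by rewrite lt_neqAle eq_sym D0 normr_ge0.
have := bnd (Num.truncn (z * (M z - M 0) / `|Del z - Del 0|)).
apply/negP; rewrite -ltNge [ltRHS]mulrC -ltr_pdivrMr//.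
exact: truncnS_gt.
Qed.

(** It is enough to compare increments of [F] with integrals of [G] on each interval up to an error
    of second order, since such errors do not accumulate. The product rule is proved in this way. *)
Lemma is_wderiv_local (F G m : R -> R) : L2 l G -> intble l m ->
  (forall a b : R, 0 <= a -> a <= b -> b <= l ->
    `|F b - F a - \int[mu]_(w in `[a, b]) G w| <= (b - a) * \int[mu]_(w in `[a, b]) m w) ->
  is_wderiv l F G.
Proof.
move=> GL mi H; split => // z; rewrite in_itv/= => /andP[z0 zl].
pose Del w := F w - \int[mu]_(v in `[0, w]) G v.
pose M w := \int[mu]_(v in `[0, w]) m v.
suff : Del z = Del 0.
  by rewrite /Del [in RHS]set_itv1 Rintegral_set1 subr0 => <-; rewrite subrK.
apply: (@quadratic_variation_const Del M) => // a b a0 ab bz.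
have bl := le_trans bz zl.
rewrite /M Rintegral_sub// /Del.
have -> : F b - \int[mu]_(v in `[0, b]) G v - (F a - \int[mu]_(v in `[0, a]) G v) =
  F b - F a - (\int[mu]_(v in `[0, b]) G v - \int[mu]_(v in `[0, a]) G v) by ring.
by rewrite Rintegral_sub//; [exact: H|exact: L2_int].
Qed.

Lemma is_wderivB f g : is_wderiv l f g -> forall a b : R, 0 <= a -> a <= b -> b <= l ->
  f b - f a = \int[mu]_(w in `[a, b]) g w.
Proof.
move=> [gL fg] a b a0 ab bl; rewrite -Rintegral_sub//; last exact: L2_int.
rewrite (fg b) ?(fg a) ?in_itv/= ?a0 ?bl ?(le_trans ab bl) ?(le_trans a0 ab)//.
ring.
Qed.

Lemma is_wderiv_osc f g : is_wderiv l f g -> forall a b u v : R, 0 <= a -> b <= l ->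
  a <= u -> u <= b -> a <= v -> v <= b ->
  `|f u - f v| <= \int[mu]_(w in `[a, b]) `|g w|.
Proof.
move=> fg a b; have gL := fg.1.
suff H (u v : R) : 0 <= a -> b <= l -> a <= u -> u <= v -> v <= b ->
    `|f u - f v| <= \int[mu]_(w in `[a, b]) `|g w|.
  move=> u v a0 bl au ub av vb; have [uv|/ltW uv] := leP u v; first exact: H.
  by rewrite distrC; exact: H.
move=> a0 bl au uv vb; rewrite distrC (is_wderivB fg)//; last first.
- exact: le_trans vb bl.
- exact: le_trans a0 au.
have gi := intble_sub (le_trans a0 au) (le_trans vb bl) (L2_int gL).
apply: (le_trans (le_normr_Rintegral _ gi)) => //.
have agi : mu.-integrable `[a, b] (EFin \o (fun w => `|g w|)).
  exact: (integrable_norm (intble_sub a0 bl (L2_int gL))).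
rewrite /Rintegral fine_le//.
- apply: integrable_fin_num => //; exact: (integrable_norm gi).
- exact: integrable_fin_num.
apply: ge0_subset_integral => //.
- by apply: (measurable_int mu); exact: agi.
- move=> w /=; rewrite !in_itv/= => /andP[uw wv].
  by rewrite (le_trans au uw) (le_trans wv vb).
Qed.

Lemma is_wderiv_cont f g : 0 < l -> is_wderiv l f g -> {within `[0, l], continuous f}.
Proof.
move=> l0 [gL fg].
have := parameterized_integral_continuous (ltW l0) (L2_int gL) => c.
have : {within `[0, l], continuous (fun z => f 0 + \int[mu]_(w in `[0, z]) g w)}.
  by move=> x; apply: cvgD; [exact: cvg_cst|exact: c].
by apply: subspace_eq_continuous => z zI; apply/esym/fg; exact: set_mem.
Qed.

(** With G and H the integrals of |g| and |h| over [a, b], replacing [k] and [f] by endpoint values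
    costs at most G H each, and 2 G H <= G^2 + H^2 is at most b - a times the integral of g^2 + h^2.
    This is the error that [is_wderiv_local] tolerates. *)
Lemma is_wderivM f g k h : 0 < l -> is_wderiv l f g -> is_wderiv l k h ->
  is_wderiv l (fun z => f z * k z) (fun z => k z * g z + f z * h z).
Proof.
move=> l0 fg kh; have gL := fg.1; have hL := kh.1.
have cf := is_wderiv_cont l0 fg; have ck := is_wderiv_cont l0 kh.
have g2i := ((L2P _ _).1 gL).2; have h2i := ((L2P _ _).1 hL).2.
have kgi := L2_int (L2M ck gL); have fhi := L2_int (L2M cf hL).
apply: (is_wderiv_local (m := fun z => g z ^+ 2 + h z ^+ 2)).
- by apply: L2D; exact: L2M.
- exact: intbleD.
move=> a b a0 ab bl.
set G := \int[mu]_(w in `[a, b]) `|g w|; set H := \int[mu]_(w in `[a, b]) `|h w|.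
have gi := intble_sub a0 bl (L2_int gL); have hi := intble_sub a0 bl (L2_int hL).
have agi : mu.-integrable `[a, b] (EFin \o (fun w => `|g w|)) := integrable_norm gi.
have ahi : mu.-integrable `[a, b] (EFin \o (fun w => `|h w|)) := integrable_norm hi.
have mI : measurable (`[a, b]%classic : set R) by [].
have err (u v w : R -> R) (W : R) : mu.-integrable `[a, b] (EFin \o u) ->
    mu.-integrable `[a, b] (EFin \o (fun z => v z * u z)) ->
    (forall z, z \in `[a, b] -> `|w z - v z| <= W) ->
    (forall z, z \in `[a, b] -> w z = w a) ->
    `|w a * (\int[mu]_(z in `[a, b]) u z) - \int[mu]_(z in `[a, b]) (v z * u z)|
      <= W * \int[mu]_(z in `[a, b]) `|u z|.
  move=> ui vui wW wa.
  have aui : mu.-integrable `[a, b] (EFin \o (fun w => `|u w|)) := integrable_norm ui.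
  have wui : mu.-integrable `[a, b] (EFin \o (fun z => w a * u z)).
    exact: (integrableZl _ _ ui).
  rewrite -RintegralZl// -RintegralB//.
  have di := integrableB _ wui vui.
  apply: (le_trans (le_normr_Rintegral _ _)) => //; first exact: di.
  rewrite -RintegralZl//; apply: le_Rintegral => //.
  + exact: (integrable_norm (di _)).
  + exact: (integrableZl _ _ aui).
  + move=> z zab; rewrite -mulrBl normrM ler_wpM2r//.
    by rewrite -(wa z)//; exact: wW.
(* [k] is frozen at [b] and [f] at [a]: f(b) k(b) - f(a) k(a) = k(b) (f(b) - f(a)) + f(a) (k(b) -
   k(a)). *)
have -> : f b * k b - f a * k a - \int[mu]_(w in `[a, b]) (k w * g w + f w * h w) =
  (k b * \int[mu]_(w in `[a, b]) g w - \int[mu]_(w in `[a, b]) (k w * g w)) +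
  (f a * \int[mu]_(w in `[a, b]) h w - \int[mu]_(w in `[a, b]) (f w * h w)).
  rewrite RintegralD//; try exact: intble_sub.
  by rewrite -(is_wderivB fg)// -(is_wderivB kh)//; ring.
apply: (le_trans (ler_normD _ _)).
have e1 := err g k (fun=> k b) H gi (intble_sub a0 bl kgi).
have e2 := err h f (fun=> f a) G hi (intble_sub a0 bl fhi).
have := lerD (e1 _ _) (e2 _ _) => {e1 e2} e.
apply: (le_trans (e _ _ _ _)) => //.
- move=> z; rewrite in_itv/= => /andP[az zb].
  exact: (is_wderiv_osc kh).
- move=> z; rewrite in_itv/= => /andP[az zb].
  exact: (is_wderiv_osc fg).
rewrite RintegralD//; try exact: intble_sub.
have := Rintegral_abs_sqr a0 ab bl gL; have := Rintegral_abs_sqr a0 ab bl hL.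
rewrite -/G -/H mulrDr; have := sqr_ge0 (G - H); nra.
Qed.

Lemma is_wderivD f g k h : is_wderiv l f g -> is_wderiv l k h ->
  is_wderiv l (fun z => f z + k z) (fun z => g z + h z).
Proof.
move=> [gL fg] [hL kh]; split=> [|z zI]; first exact: L2D.
have /andP[z0 zl] : 0 <= z <= l by move: zI; rewrite in_itv.
rewrite RintegralD//; try by apply: intble_sub => //; exact: L2_int.
by rewrite (fg z)// (kh z)//; ring.
Qed.

Lemma is_wderivZ c f g : is_wderiv l f g ->
  is_wderiv l (fun z => c * f z) (fun z => c * g z).
Proof.
move=> [gL fg]; split=> [|z zI]; first exact: L2Z.
have /andP[z0 zl] : 0 <= z <= l by move: zI; rewrite in_itv.
rewrite RintegralZl//; last by apply: intble_sub => //; exact: L2_int.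
by rewrite (fg z)//; ring.
Qed.

Lemma is_wderivBB f g k h : is_wderiv l f g -> is_wderiv l k h ->
  is_wderiv l (fun z => f z - k z) (fun z => g z - h z).
Proof.
move=> fg /(is_wderivZ (-1)) kh; have := is_wderivD fg kh.
by congr (is_wderiv _ _ _); apply/funext => z; rewrite mulN1r.
Qed.

Lemma is_wderiv_parts f g k h : 0 < l -> is_wderiv l f g -> is_wderiv l k h ->
  f 0 * k 0 = f l * k l -> ip l g k = - ip l f h.
Proof.
move=> l0 fg kh bd.
have := (is_wderivM l0 fg kh).2 l; rewrite in_itv/= (ltW l0) lexx => /(_ isT).
have cf := is_wderiv_cont l0 fg; have ck := is_wderiv_cont l0 kh.
rewrite RintegralD//; first last.
- exact: (L2_int (L2M cf kh.1)).
- exact: (L2_int (L2M ck fg.1)).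
rewrite -/(ip _ _ _) -/(ip _ _ _) (ipC l k g); lra.
Qed.

Lemma is_C1_wderiv f f' : 0 < l -> is_C1 l f f' -> is_wderiv l f f'.
Proof.
move=> l0 [cf cf' df]; split; first exact: L2_cont.
move=> z; rewrite in_itv/= => /andP[]; rewrite le_eqVlt => /predU1P[<-|z0 zl].
  by rewrite set_itv1 Rintegral_set1 addr0.
have sub : `[0, z] `<=` `[0, l].
  by move=> w /=; rewrite !in_itv/= => /andP[-> wz]; exact: le_trans wz zl.
have cfz := continuous_subspaceW sub cf; have cfz' := continuous_subspaceW sub cf'.
have [_ c0 cz] := (continuous_within_itvP f z0).1 cfz.
have dfz w : w \in `]0, z[ -> is_derive w 1 f (f' w).
  rewrite in_itv/= => /andP[w0 wz]; apply: df.
  by rewrite in_itv/= w0 (lt_le_trans wz zl).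
rewrite /Rintegral (continuous_FTC2 z0 cfz' (F := f)) //=.
- by rewrite addrCA subrr addr0.
- by split => // w /dfz[].
- by move=> w /dfz[_ dw]; rewrite derive1E.
Qed.

Lemma is_wderiv_C1 f g : 0 < l -> is_wderiv l f g ->
  {within `[0, l], continuous g} -> is_C1 l f g.
Proof.
move=> l0 fg cg; split => //; first exact: (is_wderiv_cont l0 fg).
move=> z zI; have /andP[z0 zl] : 0 < z < l by move: zI; rewrite in_itv.
have cgz : {for z, continuous g}.
  by have [+ _ _] := (continuous_within_itvP g l0).1 cg; apply; exact: zI.
have [dF eF] := continuous_FTC1_closed zl (L2_int fg.1) z0 cgz.
have dI : is_derive z 1 (fun y => \int[mu]_(t in `[0, y]) g t) (g z).
  by apply: DeriveDef; [exact: dF|rewrite -derive1E; exact: eF].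
have dF' : is_derive z 1 (fun y => f 0 + \int[mu]_(t in `[0, y]) g t) (0 + g z).
  apply: is_deriveD.
rewrite add0r in dF'.
have near_eq : \forall y \near z, f 0 + \int[mu]_(t in `[0, y]) g t = f y.
  near=> y; rewrite [RHS]fg.2// in_itv/=; apply/andP; split; apply/ltW.
    by near: y; exact: lt_nbhsr.
  by near: y; exact: lt_nbhsl.
exact: near_eq_is_derive near_eq dF'.
Unshelve. all: end_near. Qed.

Lemma is_C1_comp (Phi f f' : R -> R) : (forall s, derivable Phi s 1) ->
  continuous (derive1 Phi) -> is_C1 l f f' ->
  is_C1 l (fun z => Phi (f z)) (fun z => derive1 Phi (f z) * f' z).
Proof.
move=> dP cP [cf cf' df].
have cPhi : continuous Phi.
  by move=> s; apply: differentiable_continuous; apply/derivable1_diffP.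
split.
- by move=> z; apply: (continuous_comp (cf z)); exact: cPhi.
- apply: within_contM; last exact: cf'.
  by move=> z; apply: (continuous_comp (cf z)); exact: cP.
- move=> z zI; have dPf : is_derive (f z) 1 Phi (derive1 Phi (f z)).
    by apply: DeriveDef; [exact: dP|rewrite derive1E].
  by have dfz := df z zI; exact: is_derive1_comp.
Qed.

(** The difference [u] of the two derivatives has vanishing primitives, so it is 0 almost everywhere
    by Lebesgue differentiation; the triangle inequality then compares the norms both ways. *)
Lemma is_wderiv_uniq f g h : 0 < l -> is_wderiv l f g -> is_wderiv l f h ->
  L2norm l g = L2norm l h.
Proof.
move=> l0 fg fh.
have [uL u0] := is_wderivBB fg fh.
set u := (fun z => g z - h z) in uL u0.
have {}u0 z : z \in `[0, l] -> \int[mu]_(w in `[0, z]) u w = 0.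
  by move=> zI; have := u0 z zI; rewrite !subrr add0r.
pose U := u \_ `[0, l].
have Ui : mu.-integrable setT (EFin \o U).
  by rewrite -restrict_EFin; apply/integrable_restrict => //; rewrite setTI; exact: L2_int.
have ftc := @FTC1 _ U (BLeft (- 1)).
have Uiy y : mu.-integrable `[- 1, y] (EFin \o U) by apply: integrableS Ui.
have {}ftc := ftc Uiy (open_integrable_locally openT Ui).
have F0 x : \int[mu]_(t in `[- 1, x]) U t = 0.
  rewrite /U -Rintegral_mkcondr.
  have -> : `[- 1, x] `&` `[0, l] = `[0, Num.min x l]%classic :> set R.
    rewrite eqEsubset; split => t /=; rewrite !in_itv/= le_min.
      by move=> [/andP[_ ->] /andP[-> ->]].
    by move=> /and3P[t0 -> ->]; rewrite t0 andbT; split=> //; rewrite (le_trans _ t0)// lerN10.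
  have [x0|x0] := ltP x 0.
    by rewrite set_itv_ge ?Rintegral_set0// bnd_simp -ltNge gt_min x0.
  by apply: u0; rewrite in_itv/= le_min x0 (ltW l0)/= ge_min lexx orbT.
have u0ae : ae_eq mu `[0, l]%classic (fun z => (u z * u z)%:E) (cst 0%E).
  apply: (@filterS _ _ (ae_filter_ringOfSetsType mu) _ _ _ ftc) => z H zI.
  have /andP[z0 zl] : 0 <= z <= l by move: zI; rewrite /= in_itv.
  have zN1 : ((- 1)%:E < (z : R)%:E)%E by rewrite lte_fin (lt_le_trans _ z0)// ltrN10.
  have [_] := H zN1.
  rewrite (_ : (fun x => _) = cst 0); last exact/funext.
  by rewrite derive1_cst /U patchE mem_set// => <-; rewrite mulr0.
have uu0 : ip l u u = 0.
  rewrite /ip /Rintegral (ae_eq_integral (cst 0%E))//; first by rewrite integral0.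
  by apply: (measurable_int mu); exact: (L2_mul_int uL uL).
have nu0 : L2norm l u = 0 by rewrite L2normE uu0 sqrtr0.
have gL := fg.1; have hL := fh.1.
apply/eqP; rewrite eq_le; apply/andP; split.
  have := L2norm_triangle hL uL; rewrite nu0 addr0.
  by congr (_ <= _); apply: eq_L2norm => z _; rewrite /u; ring.
have := L2norm_triangle gL (L2Z (-1) uL); rewrite L2normZ// nu0 mulr0 addr0.
by congr (_ <= _); apply: eq_L2norm => z _; rewrite /u; ring.
Qed.

End WeakDerivative.

(** * The Sobolev norm and Poincare's inequality *)

Section SobolevNorm.
Context {R : realType}.
Context (l : R) (l_gt0 : 0 < l).
Notation mu := (@lebesgue_measure R).
Implicit Types (f g h : R -> R) (x d : @state R).

Lemma RintegralD_int f g : intble l f -> intble l g ->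
  \int[mu]_(z in `[0, l]) (f z + g z) =
  \int[mu]_(z in `[0, l]) f z + \int[mu]_(z in `[0, l]) g z.
Proof. by move=> fi gi; rewrite RintegralD. Qed.

Lemma RintegralZl_int c f : intble l f ->
  \int[mu]_(z in `[0, l]) (c * f z) = c * \int[mu]_(z in `[0, l]) f z.
Proof. by move=> fi; rewrite RintegralZl. Qed.

Lemma H01_wderiv f : H01 l f -> is_wderiv l f (wderiv l f).
Proof. by move=> [ex _]; exact: (xgetPex _ ex). Qed.

(** Frees the norm from the representative picked by [wderiv]: any convenient weak derivative
    computes it, in particular the continuous one of an [H2] function. *)
Lemma H01normE f g : is_wderiv l f g -> H01norm l f = L2norm l g.
Proof.
move=> fg; apply: (is_wderiv_uniq l_gt0 _ fg).
by apply: (@xgetPex _ _ [set g | is_wderiv l f g]); exists g.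
Qed.

Lemma H01norm_ge0 f : 0 <= H01norm l f.
Proof. exact: L2norm_ge0. Qed.

Lemma H01D f g : H01 l f -> H01 l g -> H01 l (fun z => f z + g z).
Proof.
move=> [[f' ff'] [f0 fl]] [[g' gg'] [g0 gl]]; split; last by rewrite f0 fl g0 gl addr0.
by exists (fun z => f' z + g' z); exact: is_wderivD.
Qed.

Lemma H01Z c f : H01 l f -> H01 l (fun z => c * f z).
Proof.
move=> [[f' ff'] [f0 fl]]; split; last by rewrite f0 fl mulr0.
by exists (fun z => c * f' z); exact: is_wderivZ.
Qed.

Lemma H01_cont f : H01 l f -> {within `[0, l], continuous f}.
Proof. by move=> /H01_wderiv; exact: is_wderiv_cont. Qed.

Lemma H01normD f g : H01 l f -> H01 l g ->
  H01norm l (fun z => f z + g z) <= H01norm l f + H01norm l g.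
Proof.
move=> /H01_wderiv ff /H01_wderiv gg.
by rewrite (H01normE (is_wderivD ff gg)); apply: L2norm_triangle; [exact: ff.1|exact: gg.1].
Qed.

Lemma H01normZ c f : H01 l f -> H01norm l (fun z => c * f z) = `|c| * H01norm l f.
Proof.
move=> /H01_wderiv ff.
by rewrite (H01normE (is_wderivZ c ff)) L2normZ //; exact: ff.1.
Qed.

Lemma minkowski2 (a b c d : R) :
  Num.sqrt ((a + b) ^+ 2 + (c + d) ^+ 2) <= Num.sqrt (a ^+ 2 + c ^+ 2) + Num.sqrt (b ^+ 2
    + d ^+ 2).
Proof.
have p0 (u v : R) : 0 <= u ^+ 2 + v ^+ 2 by rewrite addr_ge0 ?sqr_ge0.
have sp (u v : R) := sqrtr_ge0 (u ^+ 2 + v ^+ 2).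
rewrite -(@ler_pXn2r _ 2)// ?nnegrE ?sqrtr_ge0 ?(addr_ge0 (sp _ _) (sp _ _))//.
rewrite [leRHS]sqrrD !sqr_sqrtr ?p0//.
suff : a * b + c * d <= Num.sqrt (a ^+ 2 + c ^+ 2) * Num.sqrt (b ^+ 2 + d ^+ 2) by lra.
rewrite -sqrtrM ?p0//; apply: (le_trans (ler_norm _)).
rewrite -sqrtr_sqr ler_sqrt ?(mulr_ge0 (p0 _ _) (p0 _ _))//.
have := sqr_ge0 (a * d - c * b); nra.
Qed.

Lemma normX_ge0 x : 0 <= normX l x.
Proof. exact: sqrtr_ge0. Qed.

Lemma normX_sqr x : normX l x ^+ 2 = H01norm l x.1 ^+ 2 + x.2 ^+ 2.
Proof. by rewrite sqr_sqrtr// addr_ge0 ?sqr_ge0. Qed.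

Lemma H01norm_le_normX x : H01norm l x.1 <= normX l x.
Proof.
by rewrite -(@ler_pXn2r _ 2)// ?nnegrE ?H01norm_ge0 ?normX_ge0// normX_sqr lerDl sqr_ge0.
Qed.

Lemma snd_le_normX x : `|x.2| <= normX l x.
Proof.
rewrite -(@ler_pXn2r _ 2)// ?nnegrE ?normX_ge0// normX_sqr real_normK ?num_real//.
by rewrite lerDr sqr_ge0.
Qed.

Lemma inXD x d : inX l x -> inX l d -> inX l (x + d).
Proof. exact: H01D. Qed.

Lemma inXN x : inX l x -> inX l (- x).
Proof.
move=> /(H01Z (-1)); rewrite /inX; congr (H01 _ _).
by apply/funext => z; rewrite mulN1r.
Qed.

Lemma normXN x : inX l x -> normX l (- x) = normX l x.
Proof.
move=> xX; rewrite /normX; congr (Num.sqrt (_ ^+ 2 + _)); last exact: sqrrN.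
have := H01normZ (-1) xX; rewrite normrN1 mul1r => <-; congr H01norm.
by apply/funext => z; rewrite mulN1r.
Qed.

Lemma normXD x d : inX l x -> inX l d -> normX l (x + d) <= normX l x + normX l d.
Proof.
move=> xX dX; apply: le_trans (minkowski2 _ _ _ _).
rewrite ler_sqrt ?addr_ge0 ?sqr_ge0// lerD2r ler_pXn2r ?nnegrE ?addr_ge0 ?H01norm_ge0//.
exact: H01normD.
Qed.

Lemma normX_dist x d : inX l x -> inX l d -> `|normX l x - normX l d| <= normX l (x - d).
Proof.
move=> xX dX; have dNX := inXN dX; have xdX := inXD xX dNX.
have H1 : normX l x <= normX l (x - d) + normX l d.
  by have := normXD xdX dX; rewrite subrK.
have H2 : normX l d <= normX l (x - d) + normX l x.
  by have := normXD (inXN xdX) xX; rewrite normXN// opprB subrK.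
by rewrite ler_norml; lra.
Qed.

Lemma tan_ode (k z0 z : R) : cos (k * (z - z0)) != 0 ->
  is_derive z 1 (fun y => k * tan (k * (y - z0))) (k ^+ 2 + (k * tan (k * (z - z0))) ^+ 2).
Proof.
move=> cn0.
have dlin : is_derive z 1 (fun y => k * (y - z0)) k.
  by apply: is_derive_eq; rewrite subr0 /GRing.scale /= mulr1.
have dtan := is_derive_tan cn0.
have dcomp := @is_derive1_comp _ tan (fun y => k * (y - z0)) _ _ _ dtan dlin.
apply: (is_derive_eq (is_deriveZ k dcomp)).
by rewrite cos2_tan2// /GRing.scale/=; ring.
Qed.

(* Jacobi's trick: [w = k tan (k (z - l / 2))] solves the Riccati equation
   [w' = k^2 + w^2], and [(g + w f)^2 = g^2 - k^2 f^2 + (w f^2)']. *)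
Lemma poincare_subcritical f g k : 0 < k -> k * l < pi -> is_wderiv l f g ->
  f 0 = 0 -> f l = 0 -> k * L2norm l f <= L2norm l g.
Proof.
move=> k0 kl fg f0 fl.
pose w z : R := k * tan (k * (z - l / 2)).
have dw z : 0 <= z <= l -> is_derive z 1 w (k ^+ 2 + w z ^+ 2).
  move=> /andP[z0 zl]; apply: tan_ode; rewrite gt_eqF// cos_gt0_pihalf//.
  by apply/andP; split; nra.
have cw : {within `[0, l], continuous w}.
  apply/continuous_in_subspaceT => z /set_mem; rewrite /= in_itv/= => zI.
  by apply: differentiable_continuous; apply/derivable1_diffP; have [] := dw z zI.
have cwE : {within `[0, l], continuous (fun z => k ^+ 2 + w z ^+ 2)}.
  by move=> z; apply: cvgD; [exact: cvg_cst|exact: (within_contM cw cw)].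
have wC1 : is_wderiv l w (fun z => k ^+ 2 + w z ^+ 2).
  apply: (is_C1_wderiv l_gt0); split; [exact: cw|exact: cwE|move=> z].
  by rewrite in_itv/= => /andP[z0 zl]; apply: dw; rewrite !ltW.
have cf := is_wderiv_cont l_gt0 fg.
have ff := is_wderivM l_gt0 fg fg.
have := (is_wderivM l_gt0 wC1 ff).2 l; rewrite in_itv/= (ltW l_gt0) lexx => /(_ isT).
rewrite fl f0 !mulr0 add0r => E.
have fL := L2_cont cf; have gL := fg.1; have wfL := L2M cw fL.
have := ip_ge0 l (fun z => g z + w z * f z); rewrite ip_sqrD//.
have -> : ip l (fun z => w z * f z) (fun z => w z * f z) =
  - (k ^+ 2 * ip l f f) - 2 * ip l g (fun z => w z * f z).
  suff : k ^+ 2 * ip l f f + (2 * ip l g (fun z => w z * f z)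
      + ip l (fun z => w z * f z) (fun z => w z * f z)) = 0 by lra.
  rewrite [RHS]E -!RintegralZl_int -?RintegralD_int; first last.
  - exact: (L2_mul_int fL fL).
  - exact: (L2_mul_int gL wfL).
  - exact: (L2_mul_int wfL wfL).
  - exact: (intbleZ 2 (L2_mul_int gL wfL)).
  - exact: (intbleD (intbleZ 2 (L2_mul_int gL wfL)) (L2_mul_int wfL wfL)).
  - exact: (intbleZ _ (L2_mul_int fL fL)).
  by apply: eq_Rintegral => z _; ring.
have kF : 0 <= k * L2norm l f by rewrite mulr_ge0 ?L2norm_ge0// ltW.
move=> pos; rewrite -(@ler_pXn2r _ 2)// ?nnegrE ?L2norm_ge0//.
rewrite exprMn !L2norm_sqr; lra.
Qed.

(** At k = pi / l the tangent would blow up at the endpoints. A violation of the inequality leaves a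
    gap between |g| / |f| and pi / l, and the subcritical estimate at the midpoint of the gap is
    contradictory. *)
Lemma poincare f g : is_wderiv l f g -> f 0 = 0 -> f l = 0 ->
  L2norm l f <= l / pi * L2norm l g.
Proof.
move=> fg f0 fl; rewrite -mulrAC ler_pdivlMr ?pi_gt0// -subr_ge0 leNgt; apply/negP.
set F := L2norm l f; set G := L2norm l g => H.
have F0 : 0 < F.
  rewrite lt_neqAle eq_sym L2norm_ge0 andbT; apply/eqP => F0.
  by move: H; rewrite F0 mul0r subr0 ltNge mulr_ge0 ?L2norm_ge0// ltW.
pose k := (pi / l + G / F) / 2.
have GF : 0 <= G / F by rewrite divr_ge0 ?L2norm_ge0.
have pl : 0 < pi / l by rewrite divr_gt0 ?pi_gt0.
have GFp : G / F < pi / l.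
  by rewrite ltr_pdivrMr// mulrAC ltr_pdivlMr//; lra.
have k0 : 0 < k by rewrite /k; lra.
have kl : k * l < pi.
  by rewrite -ltr_pdivlMr// /k; lra.
have := poincare_subcritical k0 kl fg f0 fl; rewrite -/F -/G -ler_pdivlMr// /k; lra.
Qed.

Lemma poincare_H01 f : H01 l f -> L2norm l f <= l / pi * H01norm l f.
Proof. by move=> /[dup] fH [_ [f0 fl]]; apply: poincare => //; exact: H01_wderiv. Qed.

(** Here [g] may be nonzero at the endpoints. Since [f] vanishes there, |g|^2 = - <f, h> <= |f| |h|
    <= (l / pi) |g| |h|. *)
Lemma poincare2 f g h : is_wderiv l f g -> is_wderiv l g h -> f 0 = 0 -> f l = 0 ->
  L2norm l g <= l / pi * L2norm l h.
Proof.
move=> fg gh f0 fl; have cf := is_wderiv_cont l_gt0 fg.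
have [->|g0] := eqVneq (L2norm l g) 0.
  by rewrite !mulr_ge0 ?L2norm_ge0 ?invr_ge0 ?pi_ge0 ?ltW.
have gp : 0 < L2norm l g by rewrite lt_neqAle eq_sym g0 L2norm_ge0.
have E : L2norm l g ^+ 2 = - ip l f h.
  by rewrite L2norm_sqr; apply: is_wderiv_parts => //; rewrite f0 fl !mul0r.
have C := cauchy_schwarz (L2_cont cf) gh.1.
rewrite -(ler_pM2l gp) -expr2 E; apply: (le_trans (ler_norm _)); rewrite normrN.
apply: (le_trans C); rewrite mulrCA mulrA ler_wpM2r ?L2norm_ge0//.
exact: (poincare fg).
Qed.

Lemma Cnorm_ub f z : {within `[0, l], continuous f} -> z \in `[0, l] -> `|f z| <= Cnorm l f.
Proof.
move=> cf zI; apply: ub_le_sup; last by exists z.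
by have [M _ fM] := within_cont_bounded cf; exists M => _ [y yI <-]; exact: fM.
Qed.

Lemma Cnorm_ge0 f : {within `[0, l], continuous f} -> 0 <= Cnorm l f.
Proof.
move=> cf; have zI : 0 \in `[0, l] by rewrite in_itv/= lexx ltW.
exact: le_trans (Cnorm_ub cf zI).
Qed.

End SobolevNorm.

(** * Estimates for the jump map and the flow *)

Section SystemEstimates.
Context {R : realType} (l : R) (l_gt0 : 0 < l).
Notation mu := (@lebesgue_measure R).
Implicit Types (f g h : R -> R) (x d : @state R).

Lemma le_ip f g : L2 l f -> L2 l g -> ip l f g <= L2norm l f * L2norm l g.
Proof. by move=> fL gL; exact: le_trans (ler_norm _) (cauchy_schwarz fL gL). Qed.

Section Jump.
Context (delta : R) (alpha alpha_z alpha_zz beta gamma : R -> R).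
Context (alphaC2 : is_C2 l alpha alpha_z alpha_zz) (betaH : H01 l beta)
  (gammaL : L2 l gamma).

Let aW : is_wderiv l alpha alpha_z := is_C1_wderiv l_gt0 alphaC2.1.
Let azW : is_wderiv l alpha_z alpha_zz := is_C1_wderiv l_gt0 alphaC2.2.
Let ca : {within `[0, l], continuous alpha}. Proof. by case: alphaC2.1. Qed.
Let caz : {within `[0, l], continuous alpha_z}. Proof. by case: alphaC2.2. Qed.
Let cazz : {within `[0, l], continuous alpha_zz}. Proof. by case: alphaC2.2. Qed.

Let Bz := wderiv l beta.
Let BzW : is_wderiv l beta Bz := H01_wderiv betaH.

(** The square of (alpha f)_z differs from alpha^2 g^2 - alpha alpha_zz f^2 by the derivative of
    alpha alpha_z f^2, which integrates to 0 since [f] vanishes at both ends. This is the origin of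
    the two [alpha] terms of [b11]. *)
Lemma multiplier_norm f g : is_wderiv l f g -> f 0 = 0 -> f l = 0 ->
  ip l (fun z => f z * alpha_z z + alpha z * g z) (fun z => f z * alpha_z z + alpha z * g z)
  <= Cnorm l (fun z => alpha z ^+ 2) * ip l g g
     + Cnorm l (fun z => alpha z * alpha_zz z) * ip l f f.
Proof.
move=> fg f0 fl; have cf := is_wderiv_cont l_gt0 fg.
have gL := fg.1; have fL := L2_cont cf.
have ff := is_wderivM l_gt0 fg fg.
have KW := is_wderivM l_gt0 aW azW.
have EW := is_wderivM l_gt0 KW ff.
have := EW.2 l; rewrite in_itv/= (ltW l_gt0) lexx => /(_ isT).
rewrite fl f0 !mulr0 add0r => E.
have a2i : intble l (fun z => alpha z ^+ 2 * (g z * g z)).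
  have := L2_mul_int (L2M ca gL) (L2M ca gL).
  by apply: eq_integrable => // z _ /=; congr EFin; ring.
have ki : intble l (fun z => - (alpha z * alpha_zz z) * (f z * f z)).
  have := L2_mul_int (L2M ca (L2_cont cazz)) (L2Z (-1) (L2M cf fL)).
  by apply: eq_integrable => // z _ /=; congr EFin; ring.
have c2 : {within `[0, l], continuous (fun z => alpha z ^+ 2)} by exact: (within_contM ca ca).
have ck : {within `[0, l], continuous (fun z => alpha z * alpha_zz z)}
  by exact: (within_contM ca cazz).
have -> : ip l (fun z => f z * alpha_z z + alpha z * g z) (fun z => f z * alpha_z z
  + alpha z * g z) =
  \int[mu]_(z in `[0, l]) (alpha z ^+ 2 * (g z * g z) + - (alpha z * alpha_zz z) * (f z * f z)).
  rewrite -[RHS]add0r [X in _ = X + _]E -RintegralD_int; first last.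
  - exact: (intbleD a2i ki).
  - exact: (L2_int EW.1).
  by apply: eq_Rintegral => z _; ring.
rewrite -!RintegralZl_int -?RintegralD_int; first last.
- exact: (L2_mul_int gL gL).
- exact: (L2_mul_int fL fL).
- exact: (intbleZ _ (L2_mul_int fL fL)).
- exact: (intbleZ _ (L2_mul_int gL gL)).
apply: le_Rintegral => //.
- exact: (intbleD a2i ki).
- exact: (intbleD (intbleZ _ (L2_mul_int gL gL)) (intbleZ _ (L2_mul_int fL fL))).
move=> z zI; apply: lerD; apply: ler_wpM2r; rewrite -?expr2 ?sqr_ge0//.
- exact: le_trans (ler_norm _) (Cnorm_ub c2 zI).
- by apply: le_trans (ler_norm _) _; rewrite normrN; exact: (Cnorm_ub ck zI).
Qed.

Lemma jump_inX d x : inX l d -> inX l x ->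
  inX l (jump_map l delta alpha beta gamma d x).
Proof.
move=> dX xX; apply: H01D dX; apply: H01D.
  have [_ [x0 xl]] := xX; split; last by rewrite x0 xl !mulr0.
  exists (fun z => x.1 z * alpha_z z + alpha z * wderiv l x.1 z).
  exact: (is_wderivM l_gt0 aW (H01_wderiv xX)).
have := H01Z x.2 betaH; congr (H01 _ _); apply/funext => z; exact: mulrC.
Qed.

Let b11_ := b11 l alpha alpha_zz gamma.
Let b12_ := b12 l delta alpha alpha_z beta gamma.
Let b22_ := b22 l delta beta.

(** Minkowski's inequality splits off [d]. The cross terms of the two components are added before
    being estimated, which is why [b12] has alpha_z beta_z and gamma delta inside a single L^2
    norm. *)
Lemma jump_bound d x : inX l d -> inX l x ->
  normX l (jump_map l delta alpha beta gamma d x) <=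
  Num.sqrt (b11_ * H01norm l x.1 ^+ 2 + 2 * b12_ * H01norm l x.1 * `|x.2|
            + b22_ * `|x.2| ^+ 2) + normX l d.
Proof.
move=> dX xX; set p := H01norm l x.1; set q := `|x.2|.
have [_ [x0 xl]] := xX; have gW := H01_wderiv xX.
set f := x.1 in gW x0 xl p *; set g := wderiv l f in gW.
set y := x.2 in q *.
have cf := is_wderiv_cont l_gt0 gW; have fL := L2_cont cf; have gL := gW.1.
have BzL := BzW.1.
have uW := is_wderivM l_gt0 aW gW.
have vW := is_wderivZ y BzW.
have wW := is_wderivD uW vW.
set u := (fun z => f z * alpha_z z + alpha z * g z) in uW wW.
set w := (fun z => u z + y * Bz z) in wW.
have HW := is_wderivD wW (H01_wderiv dX).
set s := \int[mu]_(z in `[0, l]) (gamma z * f z) + delta * y.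
have fP : L2norm l f <= l / pi * p by exact: poincare_H01.
have pE : p = L2norm l g by [].
have p0 : 0 <= p by exact: H01norm_ge0.
have lpi : 0 <= l / pi by rewrite divr_ge0 ?pi_ge0 ?ltW.
have uL := uW.1; have wL := wW.1.
have E1 : H01norm l (jump_map l delta alpha beta gamma d x).1 <=
    L2norm l w + H01norm l d.1.
  rewrite (_ : _.1 = (fun z => alpha z * f z + y * beta z + d.1 z)); last first.
    by apply/funext => z /=; rewrite [y * _]mulrC.
  rewrite (H01normE l_gt0 HW); apply: L2norm_triangle; [exact: wL|exact: (H01_wderiv dX).1].
suff E2 : L2norm l w ^+ 2 + s ^+ 2 <= b11_ * p ^+ 2 + 2 * b12_ * p * q + b22_ * q ^+ 2.
  rewrite /normX [(jump_map _ _ _ _ _ _ _).2]/=.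
  apply: (@le_trans _ _ (Num.sqrt ((L2norm l w + H01norm l d.1) ^+ 2 + (s + d.2) ^+ 2))).
    rewrite ler_sqrt ?addr_ge0 ?sqr_ge0// lerD2r.
    by rewrite ler_pXn2r ?nnegrE ?addr_ge0 ?H01norm_ge0 ?L2norm_ge0.
  apply: (le_trans (minkowski2 _ _ _ _)); rewrite lerD2r ler_sqrt//.
  by apply: le_trans E2; rewrite addr_ge0 ?sqr_ge0.
have Y2 : q ^+ 2 = y ^+ 2 by rewrite real_normK ?num_real.
rewrite L2norm_sqr /w ip_sqrD ?ip_sqrZ//; last exact: (L2Z _ BzL).
have M := multiplier_norm gW x0 xl; rewrite -/u in M.
pose r z := alpha_z z * Bz z + gamma z * delta.
have rL : L2 l r.
  apply: L2D; first exact: (L2M caz BzL).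
  by have := L2Z delta gammaL; apply: eq_L2 => z _; rewrite mulrC.
have aBL : L2 l (fun z => alpha z * Bz z) by exact: (L2M ca BzL).
have Xc : ip l u (fun z => y * Bz z) + delta * y * ip l gamma f =
   y * (ip l f r + ip l (fun z => alpha z * Bz z) g).
  rewrite ipC ipZl//.
  have -> : ip l f r + ip l (fun z => alpha z * Bz z) g = ip l Bz u + delta * ip l gamma f.
    rewrite /ip -!RintegralZl_int -?RintegralD_int.
    - by apply: eq_Rintegral => z _; rewrite /u /r; ring.
    - exact: (L2_mul_int BzL uL).
    - exact: (intbleZ _ (L2_mul_int gammaL fL)).
    - exact: (L2_mul_int fL rL).
    - exact: (L2_mul_int aBL gL).
    - exact: (L2_mul_int gammaL fL).
  ring.
have Xb : y * (ip l f r + ip l (fun z => alpha z * Bz z) g) <= q * (b12_ * p).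
  apply: (le_trans (ler_norm _)); rewrite normrM ler_wpM2l ?normr_ge0//.
  apply: (le_trans (ler_normD _ _)).
  have c1 := cauchy_schwarz fL rL; have c2 := cauchy_schwarz aBL gL.
  rewrite /b12_ /b12 -/Bz -/r mulrDl; apply: lerD.
    apply: (le_trans c1); rewrite mulrAC ler_wpM2r ?L2norm_ge0//.
  by apply: (le_trans c2); rewrite pE.
have S : s ^+ 2 = ip l gamma f ^+ 2 + 2 * (delta * y * ip l gamma f) + delta ^+ 2 * y ^+ 2.
  by rewrite /s -/(ip l gamma f); ring.
have G2 : ip l gamma f ^+ 2 <= l ^+ 2 / pi ^+ 2 * L2norm l gamma ^+ 2 * p ^+ 2.
  rewrite -expr_div_n -!exprMn -(real_normK (num_real (ip _ _ _))).
  have lpg := mulr_ge0 (mulr_ge0 lpi (L2norm_ge0 l gamma)) p0.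
  rewrite ler_pXn2r ?nnegrE//.
  apply: (le_trans (cauchy_schwarz gammaL fL)).
  by rewrite mulrAC mulrC ler_wpM2r ?L2norm_ge0.
have F2 : ip l f f <= l ^+ 2 / pi ^+ 2 * p ^+ 2.
  have lpp := mulr_ge0 lpi p0.
  by rewrite -L2norm_sqr -expr_div_n -exprMn ler_pXn2r ?nnegrE ?L2norm_ge0.
have ck : {within `[0, l], continuous (fun z => alpha z * alpha_zz z)}
  by exact: (within_contM ca cazz).
have K0 := Cnorm_ge0 l_gt0 ck.
have M2 := ler_wpM2l K0 F2.
have bb : ip l Bz Bz = H01norm l beta ^+ 2 by rewrite -L2norm_sqr.
have gg : ip l g g = p ^+ 2 by rewrite -L2norm_sqr.
rewrite S bb Y2 /b11_ /b11 /b22_ /b22; rewrite gg in M.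
lra.
Qed.

End Jump.

Section Flow.
Context (a c : R) (Phi B D : R -> R) (BH : H01 l B) (DL : L2 l D).
Context (PhiD : forall s, derivable Phi s 1) (PhiC : continuous (derive1 Phi))
  (dPhi_le0 : forall s, derive1 Phi s <= 0) (Phi_sign : forall s, s * Phi s <= 0).

Let cPhi : continuous Phi.
Proof. by move=> s; apply: differentiable_continuous; apply/derivable1_diffP. Qed.

(** Forced by the sign condition on both sides of 0 and continuity; it removes the boundary terms
    when Phi(x) is integrated by parts. *)
Lemma Phi0 : Phi 0 = 0.
Proof.
apply/eqP; rewrite eq_le; apply/andP; split.
  apply: (cvgr_to_le (cvg_at_right_filter (@cPhi 0))).
  near=> s; have s0 : 0 < s by near: s; exact: nbhs_right_gt.
  by have := Phi_sign s; rewrite pmulr_rle0.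
apply: (cvgr_to_ge (cvg_at_left_filter (@cPhi 0))).
near=> s; have s0 : s < 0 by near: s; exact: nbhs_left_lt.
by have := Phi_sign s; rewrite nmulr_rle0.
Unshelve. all: end_near. Qed.

(** By parts this is the integral of - Phi'(f) g^2. Since [g] has a weak derivative it is
    continuous, so [f] is C^1 and the chain rule for Phi(f) is the classical one. *)
Lemma monotone_reaction f g h : is_wderiv l f g -> is_wderiv l g h -> f 0 = 0 -> f l = 0 ->
  0 <= ip l h (fun z => Phi (f z)).
Proof.
move=> fg gh f0 fl; have cg := is_wderiv_cont l_gt0 gh.
have C1 := is_wderiv_C1 l_gt0 fg cg.
have PC1 := is_C1_comp PhiD PhiC C1; have PW := is_C1_wderiv l_gt0 PC1.
rewrite (is_wderiv_parts l_gt0 gh PW); last by rewrite f0 fl Phi0 !mulr0.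
rewrite oppr_ge0 -oppr_ge0 -mulN1r -RintegralZl_int; last exact: (L2_mul_int fg.1 PW.1).
apply: Rintegral_ge0 => z _; rewrite mulN1r oppr_ge0 mulrCA -expr2.
by rewrite mulr_le0_ge0 ?sqr_ge0.
Qed.

Let F := flow_rhs l a c Phi B D.

Lemma flow_L2 d x : inX l d -> inX l x -> H2 l x.1 -> L2 l (F d x).1.
Proof.
move=> dX xX [h0 h0P].
have hP : is_wderiv2 l x.1 (wderiv2 l x.1).
  by apply: (@xgetPex _ _ [set h | is_wderiv2 l x.1 h]); exists h0.
have [g fg gh] := hP.
have cf := is_wderiv_cont l_gt0 fg.
apply: L2D; last exact: (L2_cont (H01_cont l_gt0 dX)).
apply: L2D; first apply: L2D.
- exact: L2Z gh.1.
- by apply: L2_cont => z; apply: (continuous_comp (cf z)); exact: cPhi.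
- by have := L2Z x.2 (L2_cont (H01_cont l_gt0 BH)); apply: eq_L2 => z _; rewrite mulrC.
Qed.

(** The left side is the formal time derivative of |x_z|^2. The zero boundary values of [B] and of
    the input allow an integration by parts that moves a derivative from x_zz onto them, hence their
    H_0^1 norms; [poincare2] turns the remaining |x_zz|^2 into |x_z|^2. *)
Lemma dissipation d x : inX l d -> inX l x -> H2 l x.1 ->
  - 2 * ip l (wderiv2 l x.1) (F d x).1 <=
    - (2 * pi ^+ 2 * a ^+ 2 / l ^+ 2) * H01norm l x.1 ^+ 2
    + 2 * H01norm l B * H01norm l x.1 * `|x.2| + 2 * H01norm l d.1 * H01norm l x.1.
Proof.
move=> dX xX [h0 h0P]; set p := H01norm l x.1; set q := `|x.2|.
have [h0' [x0 xl]] := xX.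
have hP : is_wderiv2 l x.1 (wderiv2 l x.1).
  by apply: (@xgetPex _ _ [set h | is_wderiv2 l x.1 h]); exists h0.
set f := x.1 in p x0 xl hP *; set h := wderiv2 l f in hP *.
have [g fg gh] := hP; have hL := gh.1; have gL := fg.1.
have cf := is_wderiv_cont l_gt0 fg.
have pE : p = L2norm l g by exact: H01normE.
have p0 : 0 <= p by exact: H01norm_ge0.
have PL : L2 l (fun z => Phi (f z)).
  by apply: L2_cont => z; apply: (continuous_comp (cf z)); exact: cPhi.
have BL : L2 l B := L2_cont (H01_cont l_gt0 BH).
have dL : L2 l d.1 := L2_cont (H01_cont l_gt0 dX).
have yBL : L2 l (fun z => x.2 * B z) := L2Z _ BL.
have byparts k : H01 l k -> ip l k h = - ip l (wderiv l k) g.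
  move=> kH; have [_ [k0 kl]] := kH.
  rewrite ipC (is_wderiv_parts l_gt0 gh (H01_wderiv kH)); last by rewrite k0 kl !mulr0.
  by rewrite ipC.
have -> : ip l h (F d x).1 = a ^+ 2 * ip l h h + ip l h (fun z => Phi (f z))
  + x.2 * ip l B h + ip l d.1 h.
  rewrite ipC (@eq_ipl _ l (F d x).1 (fun z => ((a ^+ 2 * h z + Phi (f z)) + x.2 * B z)
    + d.1 z)); last first.
    by move=> z _ /=; rewrite [x.2 * _]mulrC.
  rewrite !ipDl ?ipZl//; first by rewrite [ip l (fun z => Phi _) _]ipC.
  - exact: (L2Z _ hL).
  - exact: (L2D (L2Z _ hL) PL).
  - exact: (L2D (L2D (L2Z _ hL) PL) yBL).
rewrite (byparts _ BH) (byparts _ dX).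
have m := monotone_reaction fg gh x0 xl; rewrite -/h in m.
have c1 : x.2 * ip l (wderiv l B) g <= q * (H01norm l B * p).
  apply: (le_trans (ler_norm _)); rewrite normrM ler_wpM2l ?normr_ge0// pE.
  exact: (cauchy_schwarz (H01_wderiv BH).1 gL).
have c2 : ip l (wderiv l d.1) g <= H01norm l d.1 * p.
  by rewrite pE; exact: (le_ip (H01_wderiv dX).1 gL).
have hh : pi ^+ 2 / l ^+ 2 * p ^+ 2 <= ip l h h.
  have plp : 0 <= pi / l * p by rewrite mulr_ge0// divr_ge0 ?pi_ge0// ltW.
  rewrite -L2norm_sqr -expr_div_n -exprMn ler_pXn2r ?nnegrE ?L2norm_ge0//.
  have := poincare2 l_gt0 fg gh x0 xl; rewrite -pE.
  by rewrite mulrAC ler_pdivlMr ?pi_gt0// mulrAC ler_pdivrMr// mulrC [leRHS]mulrC.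
have a2 := ler_wpM2l (sqr_ge0 a) hh.
have -> : - (2 * pi ^+ 2 * a ^+ 2 / l ^+ 2) * p ^+ 2 =
  - 2 * (a ^+ 2 * (pi ^+ 2 / l ^+ 2 * p ^+ 2)) by ring.
lra.
Qed.

(** Two-sided, because cone invariance needs an upper rate for -q^2 and the growth of V one for
    q^2. *)
Lemma dissipation_snd d x : inX l d -> inX l x ->
  `|2 * x.2 * (F d x).2 - 2 * c ^+ 2 * `|x.2| ^+ 2| <=
    2 * (l / pi * L2norm l D) * H01norm l x.1 * `|x.2| + 2 * `|d.2| * `|x.2|.
Proof.
move=> dX xX; set p := H01norm l x.1; set q := `|x.2|; rewrite /F /= -/(ip l D x.1).
have fL : L2 l x.1 := L2_cont (H01_cont l_gt0 xX).
have := cauchy_schwarz DL fL; have fP := poincare_H01 l_gt0 xX.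
have := ler_wpM2l (L2norm_ge0 l D) fP => c1 c2; have {c1 c2} cc := le_trans c2 c1.
rewrite real_normK ?num_real//.
have -> : 2 * x.2 * (c ^+ 2 * x.2 + ip l D x.1 + d.2) - 2 * c ^+ 2 * x.2 ^+ 2 =
  2 * (x.2 * (ip l D x.1 + d.2)) by ring.
rewrite normrM ger0_norm// normrM -/q.
have q0 : 0 <= q := normr_ge0 _.
have e := ler_normD (ip l D x.1) d.2.
have := ler_wpM2l q0 (le_trans e (lerD cc (lexx _))).
rewrite /p; lra.
Qed.

End Flow.
End SystemEstimates.

(** * Left Dini derivatives *)

Section LeftDini.
Context {R : realType}.
Implicit Types (f g u : R -> R) (a b s t r m : R).

(** A bound on the upper left Dini derivative, stated without a limit superior: a slack [e] is
    allowed and the denominator is cleared. *)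
Definition left_dini_le f t r : Prop :=
  forall e, 0 < e -> \forall h \near 0^'+, f t - f (t - h) <= h * (r + e).

Lemma left_dini_leW f t r r' : r <= r' -> left_dini_le f t r -> left_dini_le f t r'.
Proof.
move=> rr' fr e e0; near=> h; have h0 : 0 < h by near: h; exact: nbhs_right_gt.
apply: (@le_trans _ _ (h * (r + e))); last by rewrite ler_wpM2l ?(ltW h0)// lerD2r.
by near: h; exact: fr.
Unshelve. all: end_near. Qed.

Lemma left_dini_leD f g t r r' : left_dini_le f t r -> left_dini_le g t r' ->
  left_dini_le (fun s => f s + g s) t (r + r').
Proof.
move=> fr gr e e0; near=> h.
have -> : f t + g t - (f (t - h) + g (t - h)) = (f t - f (t - h)) + (g t - g (t - h)) by ring.
have -> : h * (r + r' + e) = h * (r + e / 2) + h * (r' + e / 2) by field.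
apply: lerD; near: h; [apply: fr|apply: gr]; lra.
Unshelve. all: end_near. Qed.

Lemma is_derive_left_dini f t r : is_derive t 1 f r -> left_dini_le f t r.
Proof.
move=> [df fr] e e0.
have /cvgrPdist_lt/(_ _ e0) : h^-1 *: (f (h *: 1 + t) - f t) @[h --> 0^'] --> r.
  by rewrite -fr.
rewrite near_withinE => /nbhs_norm0P [d /= d0 H].
near=> h; have h0 : 0 < h by near: h; exact: nbhs_right_gt.
have := H (- h); rewrite /= normrN gtr0_norm// => /(_ _ _).
have hd : h < d by near: h; exact: nbhs_right_lt.
move=> /(_ hd); rewrite oppr_eq0 gt_eqF// => /(_ isT).
rewrite /GRing.scale/= mulr1 [- h + t]addrC => H1.
have : (- h)^-1 * (f (t - h) - f t) <= r + e.
  by move: H1; rewrite ltr_distlC => /andP[_ /ltW].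
rewrite invrN mulNr -mulrN opprB mulrC ler_pdivrMr// mulrC.
by [].
Unshelve. all: end_near. Qed.

(** At the infimum s0 of the points with u <= 0, continuity gives u(s0) = 0, while u > 0 before s0.
    So -u increases up to s0, against its negative left Dini bound there. *)
Lemma first_contact u a b :
  (forall t, a <= t -> t <= b -> {for t, continuous u}) -> 0 < u a ->
  (forall t, a < t -> t <= b -> u t = 0 ->
    exists2 r, r < 0 & left_dini_le (fun s => - u s) t r) ->
  forall t, a <= t -> t <= b -> 0 < u t.
Proof.
move=> cu ua contact t at_ tb; rewrite ltNge; apply/negP => ut.
pose S := [set s | a <= s <= t /\ u s <= 0].
have St : S t by split=> //; rewrite at_ lexx.
have Sinf : has_inf S by split; [exists t|exists a => s [/andP[]]].
set s0 := inf S.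
have as0 : a <= s0 by apply: lb_le_inf; [exists t|move=> s [/andP[]]].
have s0t : s0 <= t by apply: ge_inf => //; case: Sinf.
have s0b := le_trans s0t tb.
have pos s : a <= s -> s < s0 -> 0 < u s.
  move=> as_ ss0; rewrite ltNge; apply/negP => us.
  have : s0 <= s by apply: ge_inf; [case: Sinf|split=> //;
    rewrite as_ (ltW (lt_le_trans ss0 s0t))].
  by rewrite leNgt ss0.
have cs0 := cu _ as0 s0b.
have us0 : u s0 <= 0.
  rewrite leNgt; apply/negP => us0.
  have : \forall s \near s0, 0 < u s by exact: (cvgr_gt _ cs0).
  move=> /nbhs_normP[d /= d0 H].
  have [s [/andP[as_ st] us] sd] := inf_adherent d0 Sinf.
  suff : 0 < u s by rewrite ltNge us.
  apply: H => /=; rewrite ler0_norm ?subr_le0; first by rewrite opprB ltrBlDl.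
  by apply: ge_inf; [case: Sinf|split=> //; rewrite as_].
have as0' : a < s0.
  by rewrite lt_neqAle as0 andbT; apply: contraTneq ua => ->; rewrite -leNgt.
have us0' : u s0 = 0.
  apply/eqP; rewrite eq_le us0 /=; apply: (cvgr_to_ge (cvg_at_left_filter cs0)).
  near=> s; apply/ltW/pos; near: s; [apply: nbhs_left_ge|exact: nbhs_left_lt] => //.
have [r r0 D] := contact _ as0' s0b us0'.
have r2 : 0 < - r / 2 by lra.
have Dr := D _ r2.
have : \forall h \near (0:R)^'+, False.
  near=> h; have h0 : 0 < h by near: h; exact: nbhs_right_gt.
  have hs : h < s0 - a by near: h; apply: nbhs_right_lt; rewrite subr_gt0.
  have H1 : - u s0 - - u (s0 - h) <= h * (r + - r / 2) by near: h.
  rewrite us0' oppr0 add0r opprK in H1.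
  have as0h : a <= s0 - h by lra.
  have s0h : s0 - h < s0 by lra.
  have := pos _ as0h s0h; nra.
by move=> /filter_ex[].
Unshelve. all: end_near. Qed.


(** Gronwall's inequality for either sign of [m]. [Z e] is a strict supersolution: where it meets
    [f], the left rate of f - Z is at most - e exp((m + 1) (t - a)) < 0, so [f] stays below; then
    [e] is arbitrary. *)
Lemma left_dini_exp_bound f a b m :
  (forall t, a <= t -> t <= b -> {for t, continuous f}) ->
  (forall t, a < t -> t <= b -> left_dini_le f t (m * f t)) ->
  a <= b -> f b <= expR (m * (b - a)) * f a.
Proof.
move=> cf df ab.
pose Z e t := f a * expR (m * (t - a)) + e * expR ((m + 1) * (t - a)).
have dexp (k c t : R) : is_derive t 1 (fun s => c * expR (k * (s - a))) (k * (c * expR (k * (t - a)))).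
  have dlin : is_derive t 1 (fun y => k * (y - a)) k.
    by apply: is_derive_eq; rewrite subr0 /GRing.scale /= mulr1.
  have dc := @is_derive1_comp _ expR (fun y => k * (y - a)) t _ _ (is_derive_expR _) dlin.
  by apply: (is_derive_eq (is_deriveZ c dc)); rewrite /GRing.scale/=; ring.
have dZ e t : is_derive t 1 (Z e) (m * (f a * expR (m * (t - a))) + (m
  + 1) * (e * expR ((m + 1) * (t - a)))).
  exact: is_deriveD.
have cZ e t : {for t, continuous (Z e)}.
  by apply: differentiable_continuous; apply/derivable1_diffP; have [] := dZ e t.
have key e : 0 < e -> f b < Z e b.
  move=> e0; rewrite -subr_gt0.
  apply: (@first_contact (fun t => Z e t - f t) a b) => //.
  - by move=> t at_ tb; apply: cvgB; [exact: cZ|exact: cf].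
  - by rewrite /Z subrr !mulr0 expR0; lra.
  move=> t at_ tb ut; exists (- (e * expR ((m + 1) * (t - a)))).
    by rewrite oppr_lt0 mulr_gt0 ?expR_gt0.
  have dNZ := is_derive_left_dini (is_deriveN (dZ e t)).
  have := left_dini_leD (df t at_ tb) dNZ.
  have -> : (fun s => f s + (\- Z e) s) = (fun s => - (Z e s - f s)).
    by apply/funext => s; rewrite opprB.
  apply: left_dini_leW; have -> : f t = Z e t by lra.
  by rewrite /Z; lra.
rewrite mulrC; apply/ler_addgt0Pr => e e0.
(* Rescaled so that the perturbation equals [e] at time [b]. *)
have := key (e / expR ((m + 1) * (b - a))); rewrite /Z divfK ?gt_eqF ?expR_gt0//.
by move=> /(_ (divr_gt0 e0 (expR_gt0 _)))/ltW.
Unshelve. all: end_near. Qed.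

(** At [a] the value of [f] may be the one before a jump, so the right limit [fa] replaces it; at
    [b] only a left limit is available. The estimate on the open interval passes to both limits. *)
Lemma exp_bound_ends f a b m fa : a < b ->
  f s @[s --> a^'+] --> fa -> f s @[s --> b^'-] --> f b ->
  (forall s t, a < s -> s <= t -> t < b -> f t <= expR (m * (t - s)) * f s) ->
  forall t, a < t -> t <= b -> f t <= expR (m * (t - a)) * fa.
Proof.
move=> ab ca cb H.
have cE t (s : R) : continuous (fun s => expR (m * (t - s))).
  move=> x; apply: continuous_comp; last exact: continuous_expR.
  by apply: cvgM; [exact: cvg_cst|apply: cvgB; [exact: cvg_cst|exact: cvg_id]].
have H' t s : a < s -> s <= t -> t <= b -> f t <= expR (m * (t - s)) * f s.
  move=> as_ st; rewrite le_eqVlt => /predU1P[tb|]; last exact: H.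
  move: st; rewrite tb le_eqVlt => /predU1P[<-|sb].
    by rewrite subrr mulr0 expR0 mul1r.
  rewrite -subr_ge0.
  have cE' : continuous (fun t : R => expR (m * (t - s))).
    move=> x; apply: continuous_comp; last exact: continuous_expR.
    by apply: cvgM; [exact: cvg_cst|apply: cvgB; [exact: cvg_id|exact: cvg_cst]].
  have lim : expR (m * (x - s)) * f s - f x @[x --> b^'-] --> expR (m * (b - s)) * f s - f b.
    apply: cvgB => //; apply: cvgM; last exact: cvg_cst.
    exact: (cvg_at_left_filter (cE' b)).
  apply: (cvgr_to_ge lim); near=> x; rewrite subr_ge0; apply: H => //.
  by apply/ltW; near: x; exact: nbhs_left_gt.
move=> t at_ tb; rewrite -subr_ge0.
have lim : expR (m * (t - x)) * f x - f t @[x --> a^'+] --> expR (m * (t - a)) * fa - f t.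
  apply: cvgB; last exact: cvg_cst; apply: cvgM => //.
  exact: (cvg_at_right_filter (cE t a a)).
apply: (cvgr_to_ge lim); near=> x; rewrite subr_ge0; apply: H' => //.
by apply/ltW; near: x; exact: nbhs_right_lt.
Unshelve. all: end_near. Qed.

End LeftDini.

(* The comparison system for [p = |x_z|] and [q = |y|] on [a, b], with initial
   values [p0, q0] at [a^+]; [p] is only controlled through left Dini derivatives. *)
Record dissipative_segment {R : realType} (A b1 b2 C e a b p0 q0 : R) (p q : R -> R) : Prop :=
  DissipativeSegment {
    p_ge0 : forall t, 0 <= p t;
    q_ge0 : forall t, 0 <= q t;
    p_cont : forall t, a < t -> t < b -> {for t, continuous p};
    q_cont : forall t, a < t -> t < b -> {for t, continuous q};
    p_right : p s @[s --> a^'+] --> p0;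
    q_right : q s @[s --> a^'+] --> q0;
    p_left : p s @[s --> b^'-] --> p b;
    q_left : q s @[s --> b^'-] --> q b;
    p_dini : forall t, a < t -> t < b -> left_dini_le (fun s => p s ^+ 2) t
      (- (2 * A) * p t ^+ 2 + 2 * b1 * p t * q t + 2 * e * p t);
    q_dini : forall t, a < t -> t < b -> left_dini_le (fun s => q s ^+ 2) t
      (2 * C * q t ^+ 2 + 2 * b2 * p t * q t + 2 * e * q t);
    Nq_dini : forall t, a < t -> t < b -> left_dini_le (fun s => - q s ^+ 2) t
      (- (2 * C * q t ^+ 2) + 2 * b2 * p t * q t + 2 * e * q t) }.

(** * Growth, cone invariance and contraction on one flow interval *)

Section FlowInterval.
Context {R : realType} (A b1 b2 C lam e a b p0 q0 : R) (p q : R -> R).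
Context (A_ge0 : 0 <= A) (b1_ge0 : 0 <= b1) (b2_ge0 : 0 <= b2) (C_ge0 : 0 <= C)
  (lam_ge0 : 0 <= lam).
Context (lamP : forall u v : R,
  - (2 * A) * u ^+ 2 + 2 * (b1 + b2) * u * v + 2 * C * v ^+ 2 <= lam * (u ^+ 2 + v ^+ 2)).
Context (ab : a < b) (seg : dissipative_segment A b1 b2 C e a b p0 q0 p q).

Let p_ge0 := p_ge0 seg.
Let q_ge0 := q_ge0 seg.
Let p_cont := p_cont seg.
Let q_cont := q_cont seg.
Let p_right := p_right seg.
Let q_right := q_right seg.
Let p_left := p_left seg.
Let q_left := q_left seg.
Let p_dini := p_dini seg.
Let q_dini := q_dini seg.
Let Nq_dini := Nq_dini seg.

Let V t := p t ^+ 2 + q t ^+ 2.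
Let V0 := p0 ^+ 2 + q0 ^+ 2.
Let theta := A - b1 - b2 - C.

Let cvgV (F : set_system R) (FF : Filter F) (x y : R) : p @ F --> x -> q @ F --> y ->
  V @ F --> x ^+ 2 + y ^+ 2.
Proof. by move=> px qy; apply: cvgD; apply: cvgM. Qed.

Let V_cont t : a < t -> t < b -> {for t, continuous V}.
Proof. by move=> at_ tb; apply: cvgV; [exact: p_cont|exact: q_cont]. Qed.

Let V_dini t : a < t -> t < b -> left_dini_le V t
  (- (2 * A) * p t ^+ 2 + 2 * (b1 + b2) * p t * q t + 2 * C * q t ^+ 2 + 2 * e * (p t + q t)).
Proof.
move=> at_ tb; have := left_dini_leD (p_dini at_ tb) (q_dini at_ tb).
by apply: left_dini_leW; lra.
Qed.

(** Adding 2 e^2 to V absorbs the inputs: 2 e (p + q) <= V + 2 e^2, so they cost one unit of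
    rate. *)
Let V_growth s t : a < s -> s <= t -> t < b ->
  V t + 2 * e ^+ 2 <= expR ((lam + 1) * (t - s)) * (V s + 2 * e ^+ 2).
Proof.
move=> as_ st tb.
apply: (@left_dini_exp_bound _ (fun t => V t + 2 * e ^+ 2)) => // r.
  move=> sr rt; apply: cvgD; last exact: cvg_cst.
  by apply: V_cont; [exact: lt_le_trans sr|exact: le_lt_trans tb].
move=> sr rt; have ar := lt_trans as_ sr; have rb := le_lt_trans rt tb.
have dc : left_dini_le (fun=> 2 * e ^+ 2) r 0.
  by apply: is_derive_left_dini; exact: is_derive_cst.
have := left_dini_leD (V_dini ar rb) dc; apply: left_dini_leW.
have := lamP (p r) (q r); rewrite addr0 -/(V r) => H.
have : 2 * e * (p r + q r) <= V r + 2 * e ^+ 2.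
  by have := sqr_ge0 (e - p r); have := sqr_ge0 (e - q r); rewrite /V; nra.
have := mulr_ge0 lam_ge0 (sqr_ge0 e); lra.
Qed.

Lemma flow_growth t : a < t -> t <= b ->
  p t ^+ 2 + q t ^+ 2 + 2 * e ^+ 2 <=
  expR ((lam + 1) * (t - a)) * (p0 ^+ 2 + q0 ^+ 2 + 2 * e ^+ 2).
Proof.
apply: (@exp_bound_ends _ (fun t => V t + 2 * e ^+ 2) a b) => //.
- by apply: cvgD; [exact: cvgV|exact: cvg_cst].
- by apply: cvgD; [exact: cvgV|exact: cvg_cst].
Qed.

Context (eps : R) (eps_gt0 : 0 < eps) (eps_kap : eps < C + A - b1 - b2).

(** Since p + q <= sqrt(2 V), the input term 2 e (p + q) is at most eps V as soon as V >= 8 e^2 /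
    eps^2. *)
Let K := 8 / eps ^+ 2.

Section LargeState.
Context (V_large : forall t, a < t -> t < b -> K * e ^+ 2 < V t).

Let small_dist t : a < t -> t < b -> 2 * e * (p t + q t) <= eps * V t.
Proof.
move=> at_ tb; have := V_large at_ tb.
have -> : K * e ^+ 2 = 8 * (e / eps) ^+ 2 by rewrite /K; field; rewrite gt_eqF.
set f := e / eps; have -> : 2 * e * (p t + q t) = eps * (2 * f * (p t + q t)).
  by rewrite /f; field; rewrite gt_eqF.
move=> fV; rewrite ler_pM2l// /V; rewrite /V in fV.
by have := sqr_ge0 (2 * f - p t); have := sqr_ge0 (2 * f - q t); lra.
Qed.

Let V_rate m s t : (forall r, s <= r -> r <= t -> - (2 * A) * p r ^+ 2
      + 2 * (b1 + b2) * p r * q r + 2 * C * q r ^+ 2 <= m * V r) ->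
  a < s -> s <= t -> t < b -> V t <= expR ((m + eps) * (t - s)) * V s.
Proof.
move=> mV as_ st tb; apply: left_dini_exp_bound => // r sr rt.
  by apply: V_cont; [exact: lt_le_trans sr|exact: le_lt_trans tb].
have ar := lt_trans as_ sr; have rb := le_lt_trans rt tb.
apply: left_dini_leW (V_dini ar rb); rewrite mulrDl.
by have := mV r (ltW sr) rt; have := small_dist ar rb; lra.
Qed.

(** Where p = q, the left rate of p^2 - q^2 is at most (eps - (C + A - b1 - b2)) V < 0, so q^2 - p^2
    cannot come back to 0. This is the place where the inequality between c^2 + pi^2 a^2 / l^2 and
    the coupling norms acts. *)
Let cone_invariant s t : a < s -> s <= t -> t < b -> p s < q s -> p t < q t.
Proof.
move=> as_ st tb pq.
have cN r : s <= r -> r <= t -> {for r, continuous (fun s => q s ^+ 2 - p s ^+ 2)}.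
  move=> sr rt; have ar := lt_le_trans as_ sr; have rb := le_lt_trans rt tb.
  by apply: cvgB; apply: cvgM; (exact: p_cont || exact: q_cont).
suff : 0 < q t ^+ 2 - p t ^+ 2 by have := p_ge0 t; have := q_ge0 t; nra.
apply: (first_contact cN _ _ st (lexx t)).
  by have := p_ge0 s; nra.
move=> r sr rt qp; have ar := lt_trans as_ sr; have rb := le_lt_trans rt tb.
exists ((eps - (C + A - b1 - b2)) * V r).
  have Vr : 0 < V r by apply: le_lt_trans (V_large ar rb); rewrite mulr_ge0
    ?sqr_ge0// divr_ge0 ?sqr_ge0.
  by rewrite nmulr_rlt0// subr_lt0.
have -> : (fun s => - (q s ^+ 2 - p s ^+ 2)) = (fun s => p s ^+ 2 + - q s ^+ 2).
  by apply/funext => x; ring.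
have := left_dini_leD (p_dini ar rb) (Nq_dini ar rb); apply: left_dini_leW.
have := small_dist ar rb.
have pqr : p r = q r.
  by have := p_ge0 r; have := q_ge0 r; move: qp; nra.
rewrite /V pqr; lra.
Qed.

Lemma flow_contract : V b <= expR ((lam + eps) * (b - a)) * V0.
Proof.
apply: (exp_bound_ends ab _ _ _ ab (lexx b)); [exact: cvgV|exact: cvgV|].
by move=> s t; apply: V_rate => r _ _; exact: lamP.
Qed.

(** By invariance, q < p at [b] excludes p < q at earlier times. For q <= p, the sign of (A + C)
    (p^2 - q^2) gives -2 A p^2 + 2 C q^2 <= (C - A) V, and 2 p q <= V handles the coupling. *)
Lemma flow_contract_cone : q b < p b -> V b <= expR ((eps - theta) * (b - a)) * V0.
Proof.
move=> qp.
have cone t : a < t -> t < b -> q t <= p t.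
  move=> at_ tb; rewrite leNgt; apply/negP => pq.
  have : p b <= q b.
    rewrite -subr_ge0; have : q s - p s @[s --> b^'-] --> q b - p b by exact: cvgB.
    move/cvgr_to_ge; apply; near=> s; rewrite subr_ge0 ltW//.
    by apply: (@cone_invariant t) => //; apply/ltW; near: s; exact: nbhs_left_gt.
  by rewrite leNgt qp.
apply: (exp_bound_ends ab _ _ _ ab (lexx b)); [exact: cvgV|exact: cvgV|].
move=> s t as_ st tb; rewrite [eps - _]addrC; apply: V_rate => // r sr rt.
have := cone r (lt_le_trans as_ sr) (le_lt_trans rt tb).
have := p_ge0 r; have := q_ge0 r; rewrite /V /theta; move=> q0' p0' qpr.
have := mulr_ge0 (addr_ge0 b1_ge0 b2_ge0) (sqr_ge0 (p r - q r)).
have : 0 <= (A + C) * ((p r - q r) * (p r + q r)).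
  apply: (mulr_ge0 (addr_ge0 A_ge0 C_ge0)); apply: mulr_ge0; lra.
lra.
Unshelve. all: end_near. Qed.
End LargeState.

Lemma flow_interval :
  [\/ p b ^+ 2 + q b ^+ 2 <= expR ((lam + 1) * (b - a)) * ((8 / eps ^+ 2 + 2) * e ^+ 2),
      q b < p b /\ p b ^+ 2 + q b ^+ 2 <=
        expR ((eps - (A - b1 - b2 - C)) * (b - a)) * (p0 ^+ 2 + q0 ^+ 2) |
      p b <= q b /\ p b ^+ 2 + q b ^+ 2 <=
        expR ((lam + eps) * (b - a)) * (p0 ^+ 2 + q0 ^+ 2)].
Proof.
have [VK|VK] := pselect (forall t, a < t -> t < b -> K * e ^+ 2 < V t).
  have [qp|pq] := ltP (q b) (p b).
    by apply: Or32; split => //; exact: flow_contract_cone.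
  by apply: Or33; split => //; exact: flow_contract.
apply: Or31.
(* From this time on, V + 2 e^2 grows at rate at most lam + 1, whichever cone the state is in. *)
have [s [as_ sb Vs]] : exists s, [/\ a < s, s < b & V s <= K * e ^+ 2].
  apply: contrapT => H; apply: VK => t at_ tb; rewrite ltNge; apply/negP => Vt.
  by apply: H; exists t.
have H : V b + 2 * e ^+ 2 <= expR ((lam + 1) * (b - s)) * (V s + 2 * e ^+ 2).
  apply: (@exp_bound_ends _ (fun t => V t + 2 * e ^+ 2) s b) => //.
  - apply: cvgD; last exact: cvg_cst; apply: cvg_at_right_filter; exact: V_cont.
  - by apply: cvgD; [exact: cvgV|exact: cvg_cst].
  - by move=> x y sx; apply: V_growth; exact: lt_trans sx.
have e2 := sqr_ge0 e.
have : V b <= expR ((lam + 1) * (b - s)) * (V s + 2 * e ^+ 2) by lra.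
move=> /le_trans; apply; apply: ler_pM.
- exact: expR_ge0.
- exact: addr_ge0 (addr_ge0 (sqr_ge0 _) (sqr_ge0 _)) (mulr_ge0 (ler0n _ 2) e2).
- by rewrite ler_expR ler_wpM2l ?addr_ge0 // lerD2l lerN2 ltW.
- by rewrite [leRHS]mulrDl; apply: lerD.
Qed.

End FlowInterval.

(** * Symmetric matrices of order two *)

Section SymmetricTwoByTwo.
Context {R : realType}.
Implicit Types (P Q r u v x : R).

Lemma ord2E (i : 'I_2) : i = 0 \/ i = 1.
Proof. by case: i => [[|[|//]] i2]; [left|right]; exact/val_inj. Qed.

Lemma sym2_eigenP P Q r x : eigenvalue (sym2 P Q r) x -> (x - P) * (x - r) = Q ^+ 2.
Proof.
move=> /eigenvalueP[w wM w0].
have E0 : w 0 0 * P + w 0 1 * Q = x * w 0 0.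
  by have := congr1 (fun A : 'rV_2 => A 0 0) wM; rewrite !mxE !big_ord_recl big_ord0 /=
    !mxE /= addr0 (_ : lift _ _ = 1)//; exact/val_inj.
have E1 : w 0 0 * Q + w 0 1 * r = x * w 0 1.
  by have := congr1 (fun A : 'rV_2 => A 0 1) wM; rewrite !mxE !big_ord_recl big_ord0 /=
    !mxE /= addr0 (_ : lift _ _ = 1)//; exact/val_inj.
have F0 : ((x - P) * (x - r) - Q ^+ 2) * w 0 0 = 0.
  have -> : ((x - P) * (x - r) - Q ^+ 2) * w 0 0 = (x - r) * (x * w 0 0 - (w 0 0 * P
    + w 0 1 * Q)) + Q * (x * w 0 1 - (w 0 0 * Q + w 0 1 * r)) by ring.
  by rewrite E0 E1 !subrr !mulr0 addr0.
have F1 : ((x - P) * (x - r) - Q ^+ 2) * w 0 1 = 0.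
  have -> : ((x - P) * (x - r) - Q ^+ 2) * w 0 1 = Q * (x * w 0 0 - (w 0 0 * P
    + w 0 1 * Q)) + (x - P) * (x * w 0 1 - (w 0 0 * Q + w 0 1 * r)) by ring.
  by rewrite E0 E1 !subrr !mulr0 addr0.
apply/eqP; rewrite -subr_eq0; apply: contra_neqT w0 => /negPf n0.
move/eqP: F0; move/eqP: F1; rewrite !mulf_eq0 n0 /= => /eqP w1 /eqP w00.
apply/matrixP => i j; rewrite (ord1 i) !mxE.
by have [->|->] := ord2E j.
Qed.

Lemma sym2_eigen P Q r x : (x - P) * (x - r) = Q ^+ 2 -> eigenvalue (sym2 P Q r) x.
Proof.
move=> E; apply/eigenvalueP.
have solve (v0 v1 : R) : v0 * P + v1 * Q = x * v0 -> v0 * Q + v1 * r = x * v1 ->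
    ~~ ((v0 == 0) && (v1 == 0)) -> exists2 w : 'rV_2, w *m sym2 P Q r = x *: w & w != 0.
  move=> E0 E1 n0; exists (\row_j (if j == 0 then v0 else v1)).
    apply/matrixP => i j; rewrite (ord1 i) !mxE !big_ord_recl big_ord0 /= !mxE /= addr0.
    by have [->|->] := ord2E j.
  apply: contraNneq n0 => w0; apply/andP; split; apply/eqP.
    by have := congr1 (fun A : 'rV_2 => A 0 0) w0; rewrite !mxE.
  by have := congr1 (fun A : 'rV_2 => A 0 1) w0; rewrite !mxE.
have [Q0|Q0] := eqVneq Q 0; last first.
  (* The vector (Q, x - P) satisfies the first equation identically and the second by the
     characteristic equation. *)
  by apply: (solve Q (x - P)); [ring|rewrite -expr2 -E; ring|rewrite (negPf Q0)].
rewrite Q0 expr0n /= in E; move/eqP: E; rewrite mulf_eq0 !subr_eq0 => /orP[]/eqP xE.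
  by apply: (solve 1 0); rewrite ?Q0 ?xE ?oner_eq0//; ring.
by apply: (solve 0 1); rewrite ?Q0 ?xE ?oner_eq0 ?andbF//; ring.
Qed.

(** The larger root [m] of the characteristic polynomial attains the supremum. These three relations
    are what the later arguments use of [lambda_max]. *)
Lemma lambda_max_sym2 P Q r (lam := lambda_max (sym2 P Q r)) :
  [/\ P <= lam, r <= lam & (lam - P) * (lam - r) = Q ^+ 2].
Proof.
pose s := Num.sqrt ((P - r) ^+ 2 + 4 * Q ^+ 2).
have Q4 : 0 <= 4 * Q ^+ 2 := mulr_ge0 (ler0n _ _) (sqr_ge0 Q).
have s2 : s ^+ 2 = (P - r) ^+ 2 + 4 * Q ^+ 2 by rewrite sqr_sqrtr// addr_ge0 ?sqr_ge0.
have sPr : `|P - r| <= s.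
  by rewrite -sqrtr_sqr ler_sqrt ?addr_ge0 ?sqr_ge0// lerDl.
pose m := (P + r + s) / 2.
have mP : P <= m by move: sPr; rewrite ler_norml /m; lra.
have mr : r <= m by move: sPr; rewrite ler_norml /m; lra.
have mE : (m - P) * (m - r) = Q ^+ 2.
  have -> : (m - P) * (m - r) = (s ^+ 2 - (P - r) ^+ 2) / 4 by rewrite /m; field.
  by rewrite s2; field.
have ub : ubound [set x | eigenvalue (sym2 P Q r) x] m.
  move=> x /= /sym2_eigenP xE; rewrite leNgt; apply/negP => mx.
  suff : (m - P) * (m - r) < (x - P) * (x - r) by rewrite mE xE ltxx.
  by apply: ltr_pM; rewrite ?subr_ge0// ltrD2r.
suff -> : lam = m by [].
apply/eqP; rewrite eq_le; apply/andP; split.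
  by apply: ge_sup => //; exists m; exact: sym2_eigen.
by apply: ub_le_sup; [exists m|exact: sym2_eigen].
Qed.

(** Multiplied by lam - P, the gap between the two sides is the square of (lam - P) u - Q v. If lam
    = P, then Q = 0 and the form is diagonal. *)
Lemma sym2_form_le P Q r u v :
  P * u ^+ 2 + 2 * Q * u * v + r * v ^+ 2 <= lambda_max (sym2 P Q r) * (u ^+ 2 + v ^+ 2).
Proof.
have [] := lambda_max_sym2 P Q r; set lam := lambda_max _ => lP lr E.
have [lP0|lP0] := eqVneq lam P.
  have Q0 : Q = 0 by apply/eqP; rewrite -sqrf_eq0 -E lP0 subrr mul0r.
  by rewrite Q0 -lP0; have := sqr_ge0 v; nra.
have lPp : 0 < lam - P by rewrite subr_gt0 lt_neqAle eq_sym lP0.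
rewrite -subr_ge0 -(pmulr_rge0 _ lPp).
have -> : (lam - P) * (lam * (u ^+ 2 + v ^+ 2) - (P * u ^+ 2 + 2 * Q * u * v + r * v ^+ 2)) =
  ((lam - P) * u) ^+ 2 - 2 * (lam - P) * Q * u * v + (lam - P) * (lam - r) * v ^+ 2 by ring.
rewrite E; have := sqr_ge0 ((lam - P) * u - Q * v); lra.
Qed.

(** If w_1^2 >= w_0^2, the second row of the eigenvalue equation gives lam - r <= Q. Were r < P,
    then lam - P < lam - r <= Q, against (lam - P) (lam - r) = Q^2. The other sign is symmetric. *)
Lemma max_eigenvector_cone P Q r (w : 'cV[R]_2) : 0 <= Q ->
  max_eigenvector (sym2 P Q r) w ->
  (0 <= cone_form w -> P <= r) /\ (cone_form w < 0 -> r <= P).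
Proof.
move=> Q0 [w0 wM].
have -> : cone_form w = w 1 0 ^+ 2 - w 0 0 ^+ 2.
  rewrite /cone_form !mxE !big_ord_recl big_ord0 /= !mxE !big_ord_recl !big_ord0 /= !mxE /=.
  have -> : lift ord0 ord0 = 1 :> 'I_2 by exact/val_inj.
  by rewrite /=; ring.
have [] := lambda_max_sym2 P Q r; set lam := lambda_max _ in wM * => lP lr E.
have E0 : (lam - P) * w 0 0 = Q * w 1 0.
  have := congr1 (fun A : 'cV_2 => A 0 0) wM; rewrite !mxE !big_ord_recl big_ord0 /=
    !mxE /= addr0 (_ : lift _ _ = 1)//; last exact/val_inj.
  by move=> H; rewrite mulrBl -H; ring.
have E1 : (lam - r) * w 1 0 = Q * w 0 0.
  have := congr1 (fun A : 'cV_2 => A 1 0) wM; rewrite !mxE !big_ord_recl big_ord0 /=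
    !mxE /= addr0 (_ : lift _ _ = 1)//; last exact/val_inj.
  by move=> H; rewrite mulrBl -H; ring.
have wn0 : 0 < w 0 0 ^+ 2 + w 1 0 ^+ 2.
  rewrite lt_neqAle addr_ge0 ?sqr_ge0// andbT eq_sym paddr_eq0 ?sqr_ge0// !sqrf_eq0.
  apply: contraNN w0 => /andP[/eqP w00 /eqP w10]; apply/eqP/matrixP => i j.
  by rewrite (ord1 j) mxE; have [->|->] := ord2E i.
have S0 : (lam - P) ^+ 2 * w 0 0 ^+ 2 = Q ^+ 2 * w 1 0 ^+ 2 by rewrite -!exprMn E0.
have S1 : (lam - r) ^+ 2 * w 1 0 ^+ 2 = Q ^+ 2 * w 0 0 ^+ 2 by rewrite -!exprMn E1.
split=> c.
  rewrite leNgt; apply/negP => rP.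
  have w1 : 0 < w 1 0 ^+ 2 by lra.
  have rQ : (lam - r) ^+ 2 <= Q ^+ 2.
    by rewrite -(ler_pM2r w1) S1 ler_wpM2l ?sqr_ge0//; lra.
  have : lam - r <= Q by rewrite -(@ler_pXn2r _ 2)// nnegrE subr_ge0.
  have : 0 < lam - r by lra.
  nra.
rewrite leNgt; apply/negP => Pr.
have w1 : 0 < w 0 0 ^+ 2 by have := sqr_ge0 (w 1 0); lra.
have PQ : (lam - P) ^+ 2 <= Q ^+ 2.
  by rewrite -(ler_pM2r w1) S0 ler_wpM2l ?sqr_ge0//; lra.
have : lam - P <= Q by rewrite -(@ler_pXn2r _ 2)// nnegrE subr_ge0.
have : 0 < lam - P by lra.
nra.
Qed.

(** The sign hypothesis puts the larger weight on the smaller diagonal entry, so both entries may be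
    replaced by their mean; 2 u v <= u^2 + v^2 does the rest. For [B0] the factor is sigma / 2. *)
Lemma sym2_form_half P Q r u v : 0 <= Q -> 0 <= (r - P) * (u ^+ 2 - v ^+ 2) ->
  P * u ^+ 2 + 2 * Q * u * v + r * v ^+ 2 <= (P + 2 * Q + r) / 2 * (u ^+ 2 + v ^+ 2).
Proof. by move=> Q0 H; have := mulr_ge0 Q0 (sqr_ge0 (u - v)); lra. Qed.

End SymmetricTwoByTwo.

(** * Dwell times and gains *)

Section Gains.
Context {R : realType}.
Implicit Types (eps kap th m : R).

Lemma ln_dwell_lower vth th m : 0 < vth -> 0 <= m -> vth^-1 * ln m < th ->
  expR (- vth * th) * m < 1.
Proof.
(* For m = 0 the logarithm carries no information, but the claim reduces to 0 < 1. *)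
move=> v0; rewrite le_eqVlt => /predU1P[<-|m0]; first by rewrite mulr0.
rewrite mulrC ltr_pdivrMr// => H; rewrite mulNr expRN mulrC ltr_pdivrMr ?expR_gt0// mul1r.
by rewrite -[ltLHS](lnK m0) ltr_expR mulrC.
Qed.

Lemma ln_dwell_upper lam th m : 0 < lam -> 0 <= m -> th < - (lam^-1 * ln m) ->
  expR (lam * th) * m < 1.
Proof.
move=> l0; rewrite le_eqVlt => /predU1P[<-|m0]; first by rewrite mulr0.
rewrite -mulrN mulrC ltr_pdivlMr// => H.
by rewrite -[X in _ * X](lnK m0) -expRD -expR0 ltr_expR; lra.
Qed.

(** Both products are below 1 at eps = 0 and continuous in eps. The factor 1 + eps anticipates
    Young's inequality at the jump, the shifted rates anticipate the inputs along the flow. *)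
Lemma contraction_margin (k1 vth lam th1 th2 m1 m2 : R) : 0 < k1 ->
  expR (- vth * th1) * m1 < 1 -> expR (lam * th2) * m2 < 1 ->
  exists2 eps, 0 < eps < k1 & exists2 kap, 0 < kap < 1 &
    (1 + eps) * (expR ((eps - vth) * th1) * m1) <= kap /\
    (1 + eps) * (expR ((lam + eps) * th2) * m2) <= kap.
Proof.
move=> k0 H1 H2.
pose f (c th m eps : R) := (1 + eps) * (expR ((eps + c) * th) * m).
have cf c th m : continuous (f c th m).
  move=> x; apply: cvgM; first by apply: cvgD; [exact: cvg_cst|exact: cvg_id].
  apply: cvgM; last exact: cvg_cst.
  apply: continuous_comp; last exact: continuous_expR.
  by apply: cvgM; [apply: cvgD; [exact: cvg_id|exact: cvg_cst]|exact: cvg_cst].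
have f0 c th m : f c th m 0 = expR (c * th) * m by rewrite /f addr0 mul1r add0r.
have n1 : \forall eps \near (0:R)^'+, f (- vth) th1 m1 eps < 1.
  by apply: cvgr_lt (cvg_at_right_filter (cf (- vth) th1 m1 0)) _ _; rewrite f0.
have n2 : \forall eps \near (0:R)^'+, f lam th2 m2 eps < 1.
  by apply: cvgr_lt (cvg_at_right_filter (cf lam th2 m2 0)) _ _; rewrite f0.
have [eps [e0 e1 e2 e3]] : exists eps, [/\ 0 < eps, eps < k1, f (- vth) th1 m1 eps < 1 &
  f lam th2 m2 eps < 1].
  have : \forall eps \near (0:R)^'+, [/\ 0 < eps, eps < k1, f (- vth) th1 m1 eps < 1 &
    f lam th2 m2 eps < 1].
    near=> eps; split; near: eps; [exact: nbhs_right_gt|exact: nbhs_right_lt|exact: n1|exact: n2].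
  by move=> /filter_ex.
exists eps; first by rewrite e0.
(* The 1 / 2 keeps kap positive even when both gains vanish. *)
exists (Num.max (1 / 2) (Num.max (f (- vth) th1 m1 eps) (f lam th2 m2 eps))).
  by rewrite lt_max !gt_max e2 e3 /=; apply/andP; split; lra.
rewrite -/(f _ _ _ _) [lam + eps]addrC -/(f _ _ _ _).
by rewrite !le_max !lexx !orbT.
Unshelve. all: end_near. Qed.

Lemma linear_class_Koo (k : R) : 0 < k -> class_Koo (fun s => k * s).
Proof.
move=> k0; split.
- by apply: continuous_subspaceT => x; apply: cvgM; [exact: cvg_cst|exact: cvg_id].
- by move=> r s _ _ rs; rewrite ltr_pM2l.
- by rewrite mulr0.
- move=> M; exists ((`|M| + 1) / k); first by rewrite divr_ge0 ?addr_ge0 // ltW.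
  by rewrite mulrC divfK ?gt_eqF//; have := ler_norm M; lra.
Qed.

Lemma exp_class_KL (k eta : R) : 0 < k -> 0 < eta ->
  class_KL (fun s t => k * s * expR (- eta * t)).
Proof.
move=> k0 eta0; split.
- apply: continuous_subspaceT => -[s t] /=; apply: cvgM.
    by apply: cvgM; [exact: cvg_cst|exact: cvg_fst].
  apply: (@cvg_comp _ _ _ (fun x : R * R => - eta * x.2) expR); last exact: continuous_expR.
  by apply: cvgM; [exact: cvg_cst|exact: cvg_snd].
- by move=> t _ r s _ _ rs; rewrite ltr_pM2r ?expR_gt0// ltr_pM2l.
- by move=> t _; rewrite mulr0 mul0r.
- move=> s s0 r t _ _ rt; rewrite ltr_pM2l ?mulr_gt0// ltr_expR.
  by rewrite !mulNr ltrN2 ltr_pM2l.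
- move=> s _; rewrite -(mulr0 (k * s)); apply: cvgM; first exact: cvg_cst.
  have -> : (fun t => expR (- eta * t)) = (fun t => expR (- (eta * t))).
    by apply/funext => t; rewrite mulNr.
  apply: (@cvg_comp _ _ _ (fun t => eta * t) (fun x => expR (- x)) _ (+oo)%R); last first.
    exact: cvgr_expR.
  exact: gt0_cvgMry.
Qed.

(** The solution may cease to exist, so the recursion runs only as long as the downward closed [P]
    holds; c / (1 - kap) is the fixed point of the affine map. *)
Lemma affine_recursion_bound (kap c : R) (P : nat -> Prop) (W : nat -> R) :
  0 < kap < 1 -> 0 <= c -> (forall n, P n.+1 -> P n) ->
  (forall n, P n.+1 -> W n.+1 <= kap * W n + c) ->
  forall n, P n -> W n <= kap ^+ n * W 0%N + c / (1 - kap).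
Proof.
move=> /andP[kap0 kap1] c0 PS WS; have k1 : 0 < 1 - kap by rewrite subr_gt0.
elim=> [_|n IH Pn]; first by rewrite expr0 mul1r lerDl divr_ge0// ltW.
apply: (le_trans (WS n Pn)).
have := ler_wpM2l (ltW kap0) (IH (PS _ Pn)); rewrite mulrDr mulrA -exprS.
have : kap * (c / (1 - kap)) + c = c / (1 - kap) by field; rewrite gt_eqF.
lra.
Qed.

(** Converts contraction per jump into decay in time; [W k] is the value after jump k. The constants
    are chosen before the trajectory, its input bound and its lifetime. They depend on [t0], since
    the decay is in t and not in t - t0. *)
Lemma hybrid_bound (tau : nat -> R) (t0 th2 L m m' kap C : R) :
  impulse_times tau -> 0 < th2 -> (forall k, tau k.+1 - tau k <= th2) ->
  0 <= L -> 0 <= m -> 0 <= m' -> 0 < kap < 1 -> 0 <= C ->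
  exists M, exists N, exists eta, [/\ 0 < M, 0 < N, 0 < eta &
   forall (e : R) (T : \bar R) (V : R -> R) (W : nat -> R), 0 <= e ->
    (forall t, 0 <= V t) -> (forall k, 0 <= W k) ->
    (forall t, t0 < t -> (t%:E < T)%E -> (forall k, ~ t0 <= tau k < t) ->
       V t + 2 * e ^+ 2 <= expR (L * (t - t0)) * (V t0 + 2 * e ^+ 2)) ->
    (forall k t, t0 <= tau k -> tau k < t -> t <= tau k.+1 -> (t%:E < T)%E ->
       V t + 2 * e ^+ 2 <= expR (L * (t - tau k)) * (W k + 2 * e ^+ 2)) ->
    (forall k, t0 <= tau k -> ((tau k)%:E < T)%E -> W k <= m * V (tau k) + m' * e ^+ 2) ->
    (forall k, t0 <= tau k -> ((tau k.+1)%:E < T)%E -> W k.+1 <= kap * W k + C * e ^+ 2) ->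
    forall t, t0 <= t -> (t%:E < T)%E -> V t <= M * expR (- eta * t) * V t0 + N * e ^+ 2].
Proof.
move=> [tauS tauy] th20 dwell L0 m0 m'0 /andP[kap0 kap1] C0.
have tau_mono : {homo tau : i j / (i <= j)%N >-> i <= j}.
  by apply: homo_leq => // [x y z|i]; [exact: le_trans|exact/ltW].
have reach t : exists n, t <= tau n.
  have [n _ H] : \forall n \near \oo, t <= tau n by move/cvgryPge : tauy; exact.
  by exists n; apply: (H n) => /=.
have ex0 := reach t0.
(* The first impulse not before [t0]; when it equals [t0], the jump acts on the initial state. *)
pose k0 := ex_minn ex0.
have k0P : t0 <= tau k0 by rewrite /k0; case: ex_minnP.
have before k : (k < k0)%N -> tau k < t0.
  rewrite /k0; case: ex_minnP => n _ nmin kn; rewrite ltNge; apply/negP => /nmin.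
  by rewrite leqNgt kn.
(* An interval lasts at most th2, so a factor kap per interval is a decay in time at least at this
   rate. *)
pose eta := - ln kap / th2.
have eta0 : 0 < eta by rewrite divr_gt0// oppr_gt0 ln_lt0// kap0.
have kapE : kap = expR (- eta * th2) by rewrite /eta mulNr divfK ?gt_eqF// opprK lnK.
pose Gam := expR (L * (tau k0 - t0)).
(* Compensates exp(- eta s) up to s = tau k0 + th2, that is, for the wait before the first jump and
   for the current, unfinished interval. *)
pose Lam := expR (eta * (tau k0 + th2)).
pose Gam2 := expR (L * th2).
have G1 : 1 <= Gam by rewrite -expR0 ler_expR mulr_ge0// subr_ge0.
have G20 : 0 < Gam2 := expR_gt0 _.
have Lam0 : 0 < Lam := expR_gt0 _.
have kap1' : 0 < 1 - kap by rewrite subr_gt0.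
pose C' := C / (1 - kap).
have C'0 : 0 <= C' by rewrite divr_ge0// ltW.
pose M := Gam * Lam + Gam2 * Lam * m * Gam + 1.
pose N := 2 * Gam + Gam2 * (2 * m * Gam + m' + C' + 2) + 1.
have mG : 0 <= m * Gam by rewrite mulr_ge0//; lra.
have M0 : 0 < M.
  rewrite /M; have -> : Gam2 * Lam * m * Gam = Gam2 * Lam * (m * Gam) by ring.
  have : 0 <= Gam * Lam by rewrite mulr_ge0 ?(ltW Lam0)//; lra.
  have : 0 <= Gam2 * Lam * (m * Gam) by rewrite mulr_ge0// mulr_ge0// ltW.
  lra.
have N0 : 0 < N.
  have : 0 <= Gam2 * (2 * m * Gam + m' + C' + 2).
    by rewrite mulr_ge0 ?(ltW G20)//; lra.
  rewrite /N; lra.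
exists M, N, eta; split=> // e T V W e0 V0 W0 Hini Hflow Hjump Hcon t t0t tT.
have e2 : 0 <= e ^+ 2 := sqr_ge0 e.
have initial s : t0 <= s -> s <= tau k0 -> (s%:E < T)%E ->
    V s <= Gam * (V t0 + 2 * e ^+ 2).
  rewrite le_eqVlt => /predU1P[<- _ _|t0s sk sT].
    by have := V0 t0; nra.
  have := Hini s t0s sT; have noimp k : ~ t0 <= tau k < s.
    move=> /andP[t0k ks]; have [kk|kk] := ltnP k k0.
      by have := before _ kk; rewrite ltNge t0k.
    by have := tau_mono _ _ kk; rewrite leNgt (lt_le_trans ks sk).
  move=> /(_ noimp) H.
  have : expR (L * (s - t0)) * (V t0 + 2 * e ^+ 2) <= Gam * (V t0 + 2 * e ^+ 2).
    rewrite ler_wpM2r//; first by have := V0 t0; lra.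
    by rewrite ler_expR ler_wpM2l// lerD2r.
  lra.
have decay s : s <= tau k0 + th2 -> 1 <= Lam * expR (- eta * s).
  by move=> H; rewrite -expRD -expR0 ler_expR; nra.
have EV0 : 0 <= expR (- eta * t) * V t0 by rewrite mulr_ge0 ?expR_ge0.
have [tk|kt] := leP t (tau k0).
  have H := initial t t0t tk tT.
  have D : 1 <= Lam * expR (- eta * t) by apply: decay; lra.
  have GV : Gam * V t0 <= Gam * Lam * (expR (- eta * t) * V t0).
    have -> : Gam * Lam * (expR (- eta * t) * V t0) =
      Gam * (Lam * expR (- eta * t) * V t0) by ring.
    by rewrite ler_wpM2l ?ler_peMl//; lra.
  have : 0 <= Gam2 * (2 * m * Gam + m' + C' + 2) * e ^+ 2.
    by rewrite mulr_ge0// mulr_ge0 ?(ltW G20)//; lra.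
  have : 0 <= Gam2 * Lam * (m * Gam) * (expR (- eta * t) * V t0).
    by rewrite mulr_ge0// mulr_ge0// mulr_ge0// ltW.
  rewrite /M /N; lra.
have taukT : ((tau k0)%:E < T)%E by apply: lt_trans tT; rewrite lte_fin.
have Wk0 : W k0 <= m * Gam * (V t0 + 2 * e ^+ 2) + m' * e ^+ 2.
  have := Hjump k0 k0P taukT; have := ler_wpM2l m0 (initial _ k0P (lexx _) taukT); lra.
have t0k n : t0 <= tau (k0 + n)%N by apply: (le_trans k0P); apply: tau_mono; exact: leq_addr.
have iter n : ((tau (k0 + n)%N)%:E < T)%E -> W (k0 + n)%N <= kap ^+ n * W k0 + C' * e ^+ 2.
  have -> : C' * e ^+ 2 = (C * e ^+ 2) / (1 - kap) by rewrite /C' mulrAC.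
  rewrite -[in W k0](addn0 k0); move: n.
  apply: (@affine_recursion_bound _ _ (fun n => ((tau (k0
    + n)%N)%:E < T)%E) (fun n => W (k0 + n)%N)).
  - by rewrite kap0.
  - by rewrite mulr_ge0.
  - by move=> n; rewrite addnS; apply: lt_trans; rewrite lte_fin; exact: tauS.
  - by move=> n; rewrite addnS => nT; apply: Hcon => //; exact: t0k.
have grow n : tau (k0 + n)%N <= tau k0 + n%:R * th2.
  elim: n => [|n IH]; first by rewrite addn0 mul0r addr0.
  by rewrite addnS; have := dwell (k0 + n)%N; rewrite -natr1; lra.
have ex1 : exists n, t <= tau (k0 + n)%N.
  have [n tn] := reach t; exists n; apply: (le_trans tn); apply: tau_mono; exact: leq_addl.
(* By minimality [t] lies in the interval that follows jump k0 + n. *)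
have [[|n] tn nmin] := ex_minnP ex1; first by move: tn; rewrite addn0 leNgt kt.
have nt : tau (k0 + n)%N < t by rewrite ltNge; apply/negP => /nmin; rewrite ltnn.
have nT : ((tau (k0 + n)%N)%:E < T)%E by apply: lt_trans tT; rewrite lte_fin.
have t0n := t0k n.
rewrite addnS in tn.
have H := Hflow _ _ t0n nt tn tT.
have Wn := iter _ nT.
have H2 : expR (L * (t - tau (k0 + n)%N)) * (W (k0 + n)%N + 2 * e ^+ 2) <= Gam2 * (W (k0
  + n)%N + 2 * e ^+ 2).
  apply: ler_wpM2r; first exact: addr_ge0 (W0 _) (mulr_ge0 (ler0n _ 2) e2).
  rewrite ler_expR; apply: ler_wpM2l => //; rewrite lerBlDr.
  by apply: (le_trans tn); rewrite -lerBlDr; exact: dwell.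
have kn1 : kap ^+ n <= 1 by rewrite exprn_ile1 ?(ltW kap0) ?(ltW kap1).
have kn0 : 0 <= kap ^+ n by rewrite exprn_ge0 ?(ltW kap0).
have knE : kap ^+ n <= Lam * expR (- eta * t).
  rewrite kapE -expRM_natl -expRD ler_expR.
  have := grow n.+1; rewrite addnS -natr1 => gn.
  have tle : t <= tau k0 + th2 + n%:R * th2 by lra.
  have := ler_wpM2l (ltW eta0) tle; lra.
have S1 : kap ^+ n * W k0 <= Lam * expR (- eta * t) * (m * Gam * V t0) + (m * Gam * 2
  + m') * e ^+ 2.
  have Y := ler_wpM2l kn0 Wk0.
  have Y2 : kap ^+ n * (m * Gam * V t0) <= Lam * expR (- eta * t) * (m * Gam * V t0).
    by rewrite ler_wpM2r// mulr_ge0.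
  have Y3 : kap ^+ n * ((m * Gam * 2 + m') * e ^+ 2) <= (m * Gam * 2 + m') * e ^+ 2.
    by rewrite ler_piMl// mulr_ge0//; lra.
  lra.
have S2 : V t <= Gam2 * (Lam * expR (- eta * t) * (m * Gam * V t0) + (m * Gam * 2 + m'
  + C' + 2) * e ^+ 2).
  have : Gam2 * (W (k0 + n)%N + 2 * e ^+ 2) <=
    Gam2 * (Lam * expR (- eta * t) * (m * Gam * V t0) + (m * Gam * 2 + m' + C' + 2) * e ^+ 2).
    by rewrite ler_wpM2l ?(ltW G20)//; lra.
  lra.
have : 0 <= Gam * Lam * (expR (- eta * t) * V t0).
  by rewrite mulr_ge0// mulr_ge0 ?(ltW Lam0)//; lra.
have : 0 <= Gam * e ^+ 2 by rewrite mulr_ge0//; lra.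
rewrite /M /N; lra.
Qed.

End Gains.

(** * Solutions between impulses *)

Section Trajectory.
Context {R : realType} (l : R) (l_gt0 : 0 < l) (a c : R) (Phi B D : R -> R).
Context (BH : H01 l B) (DL : L2 l D).
Context (PhiD : forall s, derivable Phi s 1) (PhiC : continuous (derive1 Phi))
  (dPhi_le0 : forall s, derive1 Phi s <= 0) (Phi_sign : forall s, s * Phi s <= 0).
Let F := flow_rhs l a c Phi B D.

(** The reverse triangle inequality; for the first component it is applied to states whose second
    component is set to 0. *)
Lemma cvg_normX_components (FF : set_system R) (phi : R -> @state R) xp : Filter FF ->
  inX l xp -> (\forall s \near FF, inX l (phi s)) ->
  normX l (phi s - xp) @[s --> FF] --> 0 ->
  H01norm l (phi s).1 @[s --> FF] --> H01norm l xp.1 /\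
  (phi s).2 @[s --> FF] --> xp.2.
Proof.
move=> FFF xpX phiX H; split; apply/cvgrPdist_lt => e e0; near=> s.
  have sX : inX l (phi s) by near: s.
  have : normX l (phi s - xp) < e.
    by near: s; apply: cvgr_lt H _ _.
  apply: le_lt_trans.
  have H01x (x : @state R) : normX l (x.1, 0) = H01norm l x.1.
    by rewrite /normX /= expr0n addr0 sqrtr_sqr ger0_norm ?H01norm_ge0.
  have := @normX_dist _ _ l_gt0 ((phi s).1, 0) (xp.1, 0) sX xpX.
  rewrite !H01x distrC => /le_trans; apply.
  apply: le_trans (H01norm_le_normX l (phi s - xp)).
  by rewrite -H01x /normX /= subrr.
have : normX l (phi s - xp) < e by near: s; apply: cvgr_lt H _ _.
by apply: le_lt_trans; rewrite distrC; exact: (snd_le_normX l (phi s - xp)).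
Unshelve. all: end_near. Qed.

Section Derivative.
Context (phi : R -> @state R) (d : @state R) (t : R).
Context (dX : inX l d) (phiX : inX l (phi t)) (phiH2 : H2 l (phi t).1).
Context (phiF : normXhat l (h^-1 *: (phi (t + h) - phi t) - F d (phi t))
  @[h --> 0^'] --> 0).

(* Only [t - h] with [h > 0] is used: convexity gives
   [|x_z(t)|^2 - |x_z(t - h)|^2 <= 2 <x_zz(t), x(t - h) - x(t)>], so no
   continuity in time of [x_zz] or of the time derivative is needed. *)
Lemma gradient_norm_dini : (\forall h \near 0^'+, inX l (phi (t - h))) ->
  left_dini_le (fun s => H01norm l (phi s).1 ^+ 2) t
    (- 2 * ip l (wderiv2 l (phi t).1) (F d (phi t)).1).
Proof.
move=> phihX e e0.
have hP : is_wderiv2 l (phi t).1 (wderiv2 l (phi t).1).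
  by case: phiH2 => h0 h0P; apply: (@xgetPex _ _ [set h | is_wderiv2 l (phi t).1 h]); exists h0.
set x := (phi t).1 in hP *; set w := wderiv2 l x in hP *.
have [g fg gw] := hP; have gL := fg.1; have wL := gw.1.
have [_ [x0 xl]] := phiX.
have FL : L2 l (F d (phi t)).1 by exact: flow_L2.
set F1 := (F d (phi t)).1 in FL *.
(* Gives 2 |w| del <= e; the added 1 avoids a zero denominator. *)
pose del := e / (2 * (L2norm l w + 1)).
have w0 := L2norm_ge0 l w.
have del0 : 0 < del by rewrite divr_gt0// mulr_gt0// ltr_wpDl.
have : \forall h \near (0:R)^', normXhat l (h^-1 *: (phi (t + h) - phi t) - F d (phi t)) < del.
  by apply: cvgr_lt phiF _ _.
rewrite near_withinE => /nbhs_norm0P [r /= r0 H].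
near=> h.
have h0 : 0 < h by near: h; exact: nbhs_right_gt.
have hr : h < r by near: h; exact: nbhs_right_lt.
have yX : inX l (phi (t - h)) by near: h.
have := H (- h); rewrite /= normrN gtr0_norm// oppr_eq0 gt_eqF// => /(_ hr isT) Hh.
set y := (phi (t - h)).1 in yX.
have [_ [y0 yl]] := yX.
have yW := H01_wderiv yX; set gy := wderiv l _ in yW.
have xL := L2_cont (is_wderiv_cont l_gt0 fg).
have yL := L2_cont (is_wderiv_cont l_gt0 yW).
pose rm z := (- h)^-1 * (y z - x z) - F1 z.
have rmL : L2 l rm by apply: L2B FL; apply: L2Z; exact: L2B.
have rmd : L2norm l rm <= del.
  apply: le_trans (ltW Hh); rewrite -[leLHS]ger0_norm ?L2norm_ge0// -sqrtr_sqr.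
  by rewrite ler_sqrt ?addr_ge0 ?sqr_ge0// lerDl sqr_ge0.
have dW := is_wderivBB yW fg.
have parts : ip l g (fun z => gy z - g z) = - ip l w (fun z => y z - x z).
  rewrite (is_wderiv_parts l_gt0 gw dW) ?opprK//.
  by rewrite [x 0]x0 [x l]xl y0 yl subrr !mulr0.
have convex : ip l g g - ip l gy gy <= - 2 * ip l g (fun z => gy z - g z).
  have := ip_ge0 l (fun z => gy z - g z).
  have gyL := yW.1; rewrite ipBl//; last exact: L2B.
  by rewrite ![ip l _ (fun z => _ - _)]ipC !ipBl// (ipC l gy g); lra.
rewrite (H01normE l_gt0 fg) (H01normE l_gt0 yW) !L2norm_sqr.
apply: (le_trans convex); rewrite parts.
have -> : ip l w (fun z => y z - x z) = - h * (ip l w F1 + ip l w rm).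
  rewrite ipC (@eq_ipl _ l _ (fun z => - h * (F1 z + rm z))); last first.
    by move=> z _; rewrite /rm; field; rewrite gt_eqF.
  by rewrite (ipZl _ (L2D FL rmL) wL) (ipDl FL rmL wL) ![ip l w _]ipC.
have cs := cauchy_schwarz wL rmL; have := ler_norm (- ip l w rm); rewrite normrN => n1.
have b : - ip l w rm <= L2norm l w * del.
  by apply: (le_trans n1); apply: (le_trans cs); rewrite ler_wpM2l.
have b2 : 2 * (L2norm l w * del) <= e.
  have -> : 2 * (L2norm l w * del) = e * (L2norm l w / (L2norm l w + 1)).
    by rewrite /del; field; rewrite gt_eqF// ltr_wpDl.
  by rewrite ler_piMr ?(ltW e0)// ler_pdivrMr ?ltr_wpDl// mul1r lerDl.
have -> : - 2 * - (- h * (ip l w F1 + ip l w rm)) = h * (- 2 * ip l w F1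
  + 2 * (- ip l w rm)) by ring.
rewrite ler_pM2l//; lra.
Unshelve. all: end_near. Qed.

Lemma scalar_state_is_derive : is_derive t 1 (fun s => (phi s).2) (F d (phi t)).2.
Proof.
have lim : h^-1 *: ((phi (h *: 1 + t)).2 - (phi t).2) @[h --> 0^'] --> (F d (phi t)).2.
  apply/cvgrPdist_lt => e e0; near=> h.
  have : normXhat l (h^-1 *: (phi (t + h) - phi t) - F d (phi t)) < e.
    by near: h; apply: cvgr_lt phiF _ _.
  apply: le_lt_trans; rewrite distrC -sqrtr_sqr /GRing.scale /= mulr1 [h + t]addrC.
  by rewrite ler_sqrt ?addr_ge0 ?sqr_ge0// lerDr sqr_ge0.
by apply: DeriveDef; [apply/cvg_ex; exists (F d (phi t)).2|apply/cvg_lim].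
Unshelve. all: end_near. Qed.

End Derivative.

(** [xp] is the right limit at [s0]: the initial state if no jump occurs at [t0], otherwise the
    state after a jump. Derivatives are used only inside the interval, because [b] may be an impulse
    time. *)
Lemma solution_segment G tau d1 d2 t0 x0 T phi s0 b xp e : 0 <= t0 -> inU1 l d1 ->
  (forall t, 0 <= t -> normX l (d1 t) <= e) ->
  is_solution l F G tau d1 d2 t0 x0 T phi ->
  t0 <= s0 -> s0 < b -> (b%:E < T)%E ->
  (forall t, s0 < t -> t < b -> ~ range tau t) ->
  inX l xp -> normX l (phi s - xp) @[s --> s0^'+] --> 0 ->
  dissipative_segment (pi ^+ 2 * a ^+ 2 / l ^+ 2) (H01norm l B) (l / pi * L2norm l D)
    (c ^+ 2) e s0 b (H01norm l xp.1) `|xp.2|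
    (fun s => H01norm l (phi s).1) (fun s => `|(phi s).2|).
Proof.
move=> t00 d1U d1e [[_ phiX] phiL phiR _ phiD] ts0 s0b bT noimp xpX phixp.
have ltT t : t <= b -> (t%:E < T)%E by move=> tb; apply: le_lt_trans bT; rewrite lee_fin.
have X t : s0 <= t -> t <= b -> inX l (phi t).
  by move=> st tb; apply: phiX; [exact: le_trans st|exact: ltT].
have left t : s0 < t -> t <= b -> H01norm l (phi s).1 @[s --> t^'-] --> H01norm l (phi t).1 /\
    `|(phi s).2| @[s --> t^'-] --> `|(phi t).2|.
  move=> st tb; have [] := @cvg_normX_components (t^'-) phi (phi t) _ (X t (ltW st) tb).
  - near=> s; apply: X.
      by apply/ltW; near: s; exact: nbhs_left_gt.
    by apply: le_trans tb; apply/ltW; near: s; exact: nbhs_left_lt.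
  - by apply: phiL; [exact: le_lt_trans st|exact: ltT].
  by move=> cp cq; split=> //; exact: (cvg_norm cq).
have right t x : s0 <= t -> t < b -> inX l x -> normX l (phi s - x) @[s --> t^'+] --> 0 ->
    H01norm l (phi s).1 @[s --> t^'+] --> H01norm l x.1 /\
    `|(phi s).2| @[s --> t^'+] --> `|x.2|.
  move=> st tb xX cx; have [] := @cvg_normX_components (t^'+) phi x _ xX _ cx.
    near=> s; apply: X.
      by apply: (le_trans st); apply/ltW; near: s; exact: nbhs_right_gt.
    by apply/ltW; near: s; exact: nbhs_right_lt.
  by move=> cp cq; split=> //; exact: (cvg_norm cq).
have right' t : s0 < t -> t < b -> H01norm l (phi s).1 @[s --> t^'+] --> H01norm l (phi t).1 /\
    `|(phi s).2| @[s --> t^'+] --> `|(phi t).2|.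
  move=> st tb; apply: right => //; first exact: ltW.
    by apply: X; exact: ltW.
  by apply: phiR; [exact: le_trans (ltW st)|exact/ltT/ltW|exact: noimp].
have dX t : t0 <= t -> inX l (d1 t) by move=> tt; case: d1U => + _ _ _; apply; exact: le_trans tt.
have data t : s0 < t -> t < b -> [/\ inX l (d1 t), inX l (phi t), normX l (d1 t) <= e,
    H2 l (phi t).1 & normXhat l (h^-1 *: (phi (t
      + h) - phi t) - F (d1 t) (phi t)) @[h --> 0^'] --> 0].
  move=> st tb; have tt : t0 < t by exact: le_lt_trans st.
  have [h2 h1] := phiD t tt (ltT _ (ltW tb)) (noimp t st tb).
  split=> //; [exact/dX/ltW|by apply: X; exact: ltW|].
  by apply: d1e; rewrite (le_trans t00)// ltW.
have qdiff t : s0 < t -> t < b -> is_derive t 1 (fun s => `|(phi s).2| ^+ 2)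
    (2 * (phi t).2 * (F (d1 t) (phi t)).2).
  move=> st tb; have [_ _ _ _ h1] := data t st tb.
  have dy := scalar_state_is_derive h1.
  have -> : (fun s => `|(phi s).2| ^+ 2) = (fun s => (phi s).2 * (phi s).2).
    by apply/funext => s; rewrite real_normK ?num_real// expr2.
  by apply: (is_derive_eq (is_deriveM dy dy)); rewrite /GRing.scale/=; ring.
have qbound t : s0 < t -> t < b ->
    `|2 * (phi t).2 * (F (d1 t) (phi t)).2 - 2 * c ^+ 2 * `|(phi t).2| ^+ 2| <=
    2 * (l / pi * L2norm l D) * H01norm l (phi t).1 * `|(phi t).2| + 2 * e * `|(phi t).2|.
  move=> st tb; have [dtX pX de _ _] := data t st tb.
  apply: (le_trans (dissipation_snd l_gt0 a c Phi B DL dtX pX)); rewrite lerD2l.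
  rewrite ler_wpM2r// ler_wpM2l//; exact: le_trans (snd_le_normX l (d1 t)) de.
split.
- by move=> t; exact: H01norm_ge0.
- by move=> t; exact: normr_ge0.
- move=> t st tb; apply/left_right_continuousP; split.
    by have [] := left t st (ltW tb).
  by have [] := right' t st tb.
- move=> t st tb; apply/left_right_continuousP; split.
    by have [] := left t st (ltW tb).
  by have [] := right' t st tb.
- by have [] := right s0 xp (lexx _) s0b xpX phixp.
- by have [] := right s0 xp (lexx _) s0b xpX phixp.
- by have [] := left b s0b (lexx _).
- by have [] := left b s0b (lexx _).
- move=> t st tb; have [dtX pX de h2 h1] := data t st tb.
  apply: (@left_dini_leW _ _ _ (- 2 * ip l (wderiv2 l (phi t).1) (F (d1 t) (phi t)).1)).
    apply: (le_trans (dissipation l_gt0 a c D BH PhiD PhiC dPhi_le0 Phi_sign dtX pX h2)).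
    have : 2 * H01norm l (d1 t).1 * H01norm l (phi t).1 <= 2 * e * H01norm l (phi t).1.
      rewrite ler_wpM2r ?H01norm_ge0// ler_wpM2l//.
      exact: le_trans (H01norm_le_normX l (d1 t)) de.
    have -> : 2 * pi ^+ 2 * a ^+ 2 / l ^+ 2 = 2 * (pi ^+ 2 * a ^+ 2 / l ^+ 2) by ring.
    lra.
  apply: gradient_norm_dini => //; near=> h; apply: X.
    have : h < t - s0 by near: h; apply: nbhs_right_lt; rewrite subr_gt0.
    by rewrite ltrBrDl => /ltW; rewrite -lerBrDr.
  have h0 : 0 < h by near: h; exact: nbhs_right_gt.
  by rewrite lerBlDr ltW// (lt_trans tb)// ltrDl.
- move=> t st tb; apply: left_dini_leW (is_derive_left_dini (qdiff t st tb)).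
  by have := qbound t st tb; rewrite ler_norml => /andP[_]; lra.
- move=> t st tb.
  apply: left_dini_leW (is_derive_left_dini (is_deriveN (qdiff t st tb))).
  by have := qbound t st tb; rewrite ler_norml => /andP[+ _]; lra.
Unshelve. all: end_near. Qed.

End Trajectory.

(** * Combining flow factors with jump factors *)

Section Assembly.
Context {R : realType}.

(** Makes the two alternatives of the theorem uniform: [m1] is the jump gain on the cone v <= u,
    [m2] the one on u <= v. The alternatives exchange sigma / 2 and lambda_max(B_0) between them. *)
Lemma two_gain_bounds (P Q r lamB th1 th2 vth lam : R) (w : 'cV[R]_2) :
  0 <= P -> 0 <= Q -> 0 <= r -> max_eigenvector (sym2 P Q r) w ->
  0 < vth -> 0 < lam -> lamB = lambda_max (sym2 P Q r) ->
  [/\ 0 <= cone_form w, vth^-1 * ln ((P + 2 * Q + r) / 2) < th1 &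
      th2 < - (lam^-1 * ln lamB)] \/
  [/\ cone_form w < 0, vth^-1 * ln lamB < th1 &
      th2 < lam^-1 * ln (2 / (P + 2 * Q + r))] ->
  exists m1, exists m2, [/\ 0 <= m1, 0 <= m2,
    expR (- vth * th1) * m1 < 1 /\ expR (lam * th2) * m2 < 1,
    (forall u v, 0 <= v -> v <= u -> P * u ^+ 2 + 2 * Q * u * v + r * v ^+ 2 <=
      m1 * (u ^+ 2 + v ^+ 2)) &
    (forall u v, 0 <= u -> u <= v -> P * u ^+ 2 + 2 * Q * u * v + r * v ^+ 2 <=
      m2 * (u ^+ 2 + v ^+ 2))].
Proof.
move=> P0 Q0 r0 wM vth0 lam0 lamBE H.
have s0 : 0 <= (P + 2 * Q + r) / 2 by lra.
have lamB0 : 0 <= lamB by rewrite lamBE; case: (lambda_max_sym2 P Q r) => + _ _; exact: le_trans.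
have [Pr rP] := max_eigenvector_cone Q0 wM.
have form u v : P * u ^+ 2 + 2 * Q * u * v + r * v ^+ 2 <= lamB * (u ^+ 2 + v ^+ 2).
  by rewrite lamBE; exact: sym2_form_le.
case: H => [[/Pr Pr' H1 H2]|[/rP rP' H1 H2]].
  exists ((P + 2 * Q + r) / 2), lamB; split => //.
  - by split; [exact: ln_dwell_lower|exact: ln_dwell_upper].
  - move=> u v v0 vu; apply: sym2_form_half => //; rewrite mulr_ge0 ?subr_ge0//.
    by rewrite ler_pXn2r ?nnegrE// (le_trans v0).
exists lamB, ((P + 2 * Q + r) / 2); split => //.
- split; first exact: ln_dwell_lower.
  (* If sigma = 0, the conventions for the inverse and the logarithm of 0 make both bounds on [th2]
     equal to 0. *)
  apply: ln_dwell_upper => //; move: s0; rewrite le_eqVlt => /predU1P[s0|s0].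
    rewrite -s0 ln0// mulr0 oppr0; move: H2.
    have -> : P + 2 * Q + r = 0 by lra.
    by rewrite invr0 mulr0 ln0// mulr0.
  by rewrite -mulrN -lnV ?posrE// invf_div.
- move=> u v u0 uv; apply: sym2_form_half => //; rewrite mulr_le0// subr_le0//.
  by rewrite ler_pXn2r ?nnegrE// (le_trans u0).
Qed.

(* Young's inequality: [2 x e <= eps x^2 + e^2 / eps]. *)
Lemma jump_sqr_bound (eps n m V e f d : R) : 0 < eps -> 0 <= n -> 0 <= m * V ->
  n <= Num.sqrt f + d -> f <= m * V -> d <= e ->
  n ^+ 2 <= (1 + eps) * (m * V) + (1 + eps^-1) * e ^+ 2.
Proof.
move=> eps0 n0 mV0 nf fV de.
have sV : Num.sqrt f <= Num.sqrt (m * V) by rewrite ler_sqrt.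
have : n <= Num.sqrt (m * V) + e by apply: le_trans nf _; exact: lerD.
have := sqr_sqrtr mV0; have := sqrtr_ge0 (m * V).
set x := Num.sqrt (m * V) => x0 xE nx.
have : n ^+ 2 <= (x + e) ^+ 2 by rewrite ler_pXn2r ?nnegrE// (le_trans n0).
have : 0 <= eps * (x - e / eps) ^+ 2 by rewrite mulr_ge0 ?sqr_ge0// ltW.
have -> : eps * (x - e / eps) ^+ 2 = eps * x ^+ 2 - 2 * x * e + eps^-1 * e ^+ 2 by field;
  rewrite gt_eqF.
rewrite -xE; lra.
Qed.

Lemma sqrt_gain_bound (M N n s E e : R) : 0 <= M -> 0 <= N -> 0 <= n -> 0 <= s ->
  0 <= E -> 0 <= e -> n ^+ 2 <= M * s ^+ 2 * E ^+ 2 + N * e ^+ 2 ->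
  n <= Num.sqrt M * s * E + Num.sqrt N * e.
Proof.
move=> M0 N0 n0 s0 E0 e0 H.
have X0 : 0 <= Num.sqrt M * s * E by rewrite !mulr_ge0 ?sqrtr_ge0.
have Y0 : 0 <= Num.sqrt N * e by rewrite mulr_ge0 ?sqrtr_ge0.
rewrite -(@ler_pXn2r _ 2)// ?nnegrE ?addr_ge0//; apply: (le_trans H).
rewrite sqrrD !exprMn !sqr_sqrtr//; have := mulr_ge0 X0 Y0; lra.
Qed.

Lemma gain_step (eps m V E E' W kap x c c' s : R) : 0 <= eps -> 0 <= m -> 0 <= W -> 0 <= s ->
  V <= E * W -> E <= E' -> (1 + eps) * (E' * m) <= kap ->
  x <= (1 + eps) * (m * V) + c * s -> c <= c' -> x <= kap * W + c' * s.
Proof.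
move=> eps0 m0 W0 s0 VE EE' kapP xP cc'; apply: (le_trans xP); apply: lerD; last exact: ler_wpM2r.
apply: le_trans (ler_wpM2r W0 kapP); rewrite -!mulrA; apply: ler_wpM2l; first exact: addr_ge0.
by rewrite mulrCA; apply: ler_wpM2l => //; apply: (le_trans VE); exact: ler_wpM2r.
Qed.

(** The value before the jump is already a multiple of [s] = e^2; the nonnegative [w] is added to
    give the result the same shape as that of [gain_step]. *)
Lemma reset_step (eps m V E E' k s x c w : R) : 0 <= eps -> 0 <= m -> 0 <= k -> 0 <= s ->
  0 <= w -> V <= E * (k * s) -> E <= E' -> x <= (1 + eps) * (m * V) + c * s ->
  x <= w + ((1 + eps) * (m * (E' * k)) + c) * s.
Proof.
move=> eps0 m0 k0 s0 w0 VE EE' xP; apply: (le_trans xP);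
  rewrite [leRHS]addrC [in leRHS]mulrDl -[leRHS]addrA.
apply: lerD; last by rewrite lerDl.
rewrite -!mulrA; apply: ler_wpM2l; first exact: addr_ge0.
apply: ler_wpM2l => //; apply: (le_trans VE); apply: ler_wpM2r => //; exact: mulr_ge0.
Qed.

End Assembly.

Theorem proposition3 (R : realType) (a c l delta : R) (Phi : R -> R)
    (alpha alpha_z alpha_zz beta gamma B D : R -> R)
    (rhoA rhoB : 'cV[R]_2) (theta1 theta2 : R)
    (a_gt0 : 0 < a) (c_gt0 : 0 < c) (l_gt0 : 0 < l)
    (alphaC2 : is_C2 l alpha alpha_z alpha_zz)
    (betaH : H01 l beta) (BH : H01 l B) (gammaL : L2 l gamma) (DL : L2 l D)
    (PhiC1 : (forall s, derivable Phi s 1) /\ continuous (derive1 Phi))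
    (dPhi_lip : forall s : R, exists k : R, exists2 U : set R,
      nbhs s U & k.-lipschitz_U (derive1 Phi))
    (dPhi_le0 : forall s, derive1 Phi s <= 0)
    (Phi_sign : forall s, s * Phi s <= 0)
    (rhoAP : max_eigenvector (A0 l a c B D) rhoA)
    (rhoBP : max_eigenvector
      (B0 l delta alpha alpha_z alpha_zz beta gamma) rhoB)
    (hcone : l / pi * L2norm l D + H01norm l B
             < c ^+ 2 + pi ^+ 2 * a ^+ 2 / l ^+ 2)
    (vartheta_gt0 : 0 < vartheta l a c B D)
    (rhoA_cone : 0 < cone_form rhoA) :
  let lamA := lambda_max (A0 l a c B D) in
  let lamB := lambda_max (B0 l delta alpha alpha_z alpha_zz beta gamma) in
  let sig := sigma l delta alpha alpha_z alpha_zz beta gamma in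
  let vth := vartheta l a c B D in
  [/\ 0 <= cone_form rhoB,
      vth^-1 * ln (sig / 2) < theta1,
      theta1 <= theta2 &
      theta2 < - (lamA^-1 * ln lamB)]
  \/
  [/\ cone_form rhoB < 0,
      vth^-1 * ln lamB < theta1,
      theta1 <= theta2 &
      theta2 < lamA^-1 * ln (2 / sig)] ->
  forall tau : nat -> R, impulse_times tau ->
    (forall k, theta1 <= tau k.+1 - tau k <= theta2) ->
    ISS l (flow_rhs l a c Phi B D) (jump_map l delta alpha beta gamma) tau.
Proof.
move=> lamA lamB sig vth Hab tau tauP dwell.
set A := pi ^+ 2 * a ^+ 2 / l ^+ 2; set b1 := H01norm l B.
set b2 := l / pi * L2norm l D; set C := c ^+ 2.
have A_ge0 : 0 <= A by exact: divr_ge0 (mulr_ge0 (sqr_ge0 _) (sqr_ge0 _)) (sqr_ge0 _).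
have b1_ge0 : 0 <= b1 by exact: H01norm_ge0.
have lpi : 0 <= l / pi by rewrite divr_ge0 ?pi_ge0 ?ltW.
have b2_ge0 : 0 <= b2 by rewrite mulr_ge0 ?L2norm_ge0.
have C_gt0 : 0 < C by rewrite exprn_gt0.
have A0E : A0 l a c B D = sym2 (- (2 * A)) (b1 + b2) (2 * C).
  by rewrite /A0; congr (sym2 (- _) _ _); rewrite /A; ring.
have lamP u v : - (2 * A) * u ^+ 2 + 2 * (b1 + b2) * u * v + 2 * C * v ^+ 2
    <= lamA * (u ^+ 2 + v ^+ 2).
  by rewrite /lamA A0E; exact: sym2_form_le.
have lamA_gt0 : 0 < lamA.
  have [_ + _] := lambda_max_sym2 (- (2 * A)) (b1 + b2) (2 * C).
  by rewrite -A0E; apply: lt_le_trans; rewrite mulr_gt0.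
have lamA_ge0 := ltW lamA_gt0.
have [ca _ _] := alphaC2.1; have [_ cazz _] := alphaC2.2.
set P := b11 l alpha alpha_zz gamma; set Q := b12 l delta alpha alpha_z beta gamma.
set r := b22 l delta beta.
have P_ge0 : 0 <= P.
  have lpi2 : 0 <= l ^+ 2 / pi ^+ 2 by exact: divr_ge0 (sqr_ge0 _) (sqr_ge0 _).
  apply: addr_ge0; last exact: mulr_ge0 lpi2 (sqr_ge0 _).
  apply: addr_ge0; first exact: (Cnorm_ge0 l_gt0 (within_contM ca ca)).
  by apply: mulr_ge0 => //; exact: (Cnorm_ge0 l_gt0 (within_contM ca cazz)).
have Q_ge0 : 0 <= Q by exact: addr_ge0 (mulr_ge0 lpi (L2norm_ge0 _ _)) (L2norm_ge0 _ _).
have r_ge0 : 0 <= r by exact: addr_ge0 (sqr_ge0 _) (sqr_ge0 _).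
have lamB_ge0 : 0 <= lamB.
  by have [+ _ _] := lambda_max_sym2 P Q r; exact: le_trans.
have Bform u v : P * u ^+ 2 + 2 * Q * u * v + r * v ^+ 2 <= lamB * (u ^+ 2 + v ^+ 2).
  exact: sym2_form_le.
have th12 : theta1 <= theta2 by case: Hab => -[].
have [m1 [m2 [m1_ge0 m2_ge0 [H1 H2] form1 form2]]] :
  exists m1, exists m2, [/\ 0 <= m1, 0 <= m2,
    expR (- vth * theta1) * m1 < 1 /\ expR (lamA * theta2) * m2 < 1,
    (forall u v, 0 <= v -> v <= u -> P * u ^+ 2 + 2 * Q * u * v + r * v ^+ 2 <=
      m1 * (u ^+ 2 + v ^+ 2)) &
    (forall u v, 0 <= u -> u <= v -> P * u ^+ 2 + 2 * Q * u * v + r * v ^+ 2 <=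
      m2 * (u ^+ 2 + v ^+ 2))].
  apply: (@two_gain_bounds _ P Q r lamB theta1 theta2 vth lamA rhoB) => //.
  by case: Hab => -[? ? _ ?]; [left|right].
clearbody lamA lamB.
have kap_gt0 : 0 < C + A - b1 - b2 by move: hcone; rewrite -/b1 -/b2 -/C -/A; lra.
(* eps must respect the cone margin, and stay below vartheta so that eps - vartheta remains a decay
   rate. *)
have k1_gt0 : 0 < Num.min (C + A - b1 - b2) vth by rewrite lt_min kap_gt0.
have [eps /andP[eps_gt0]] := contraction_margin k1_gt0 H1 H2.
rewrite lt_min => /andP[eps_kap eps_vth] [kap kap01 [G1 G2]].
have th2_gt0 : 0 < theta2.
  have /andP[_] := dwell 0%N; apply: lt_le_trans; rewrite subr_gt0; exact: tauP.1.
have epsV : 0 <= eps^-1 by rewrite invr_ge0 ltW.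
have L_ge0 : 0 <= lamA + 1 by exact: addr_ge0.
(* The coefficient of e^2 when V has been below the threshold: growth from there to the next
   impulse, then a jump. It also dominates the Young remainder 1 + 1 / eps of the other two
   cases. *)
pose C1 := (1 + eps) * (lamB * (expR ((lamA + 1) * theta2) * (8 / eps ^+ 2 + 2))) + (1 + eps^-1).
have C1_ge0 : 0 <= C1.
  apply: addr_ge0; last by rewrite addr_ge0.
  apply: mulr_ge0; first by rewrite addr_ge0 ?(ltW eps_gt0).
  apply: mulr_ge0 => //; apply: mulr_ge0; first exact: expR_ge0.
  by rewrite addr_ge0// divr_ge0 ?sqr_ge0.
move=> t0 t00.
have dwell2 k : tau k.+1 - tau k <= theta2 by case/andP: (dwell k).
(* The gains 2 lambda_max(B_0) and 2 for a single jump come from Young's inequality with parameter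
   1. *)
have [M [N [eta [M_gt0 N_gt0 eta_gt0 HB]]]] := hybrid_bound t0 tauP th2_gt0 dwell2 L_ge0
  (mulr_ge0 (ler0n R 2) lamB_ge0) (ler0n R 2) kap01 C1_ge0.
(* The bound obtained concerns squared norms; taking roots halves the rate. *)
exists (fun s t => Num.sqrt M * s * expR (- (eta / 2) * t)), (fun s => Num.sqrt N * s).
split; [by apply: exp_class_KL; rewrite ?sqrtr_gt0 ?divr_gt0|by apply: linear_class_Koo;
  rewrite sqrtr_gt0|].
move=> x0 d1 d2 T phi x0X d1U d2U sol t t0t tT.
set e := Num.max (normU1 l d1) (normU2 l d2).
have d1e s : 0 <= s -> normX l (d1 s) <= e.
  move=> s0; rewrite le_max; apply/orP; left; case: d1U => _ ub _ _.
  by apply: ub_le_sup => //; exists s => //; rewrite /= in_itv/= s0.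
have d2e k : normX l (d2 k) <= e.
  rewrite le_max; apply/orP; right; case: d2U => _ ub.
  by apply: ub_le_sup => //; exists k.
have e_ge0 : 0 <= e := le_trans (normX_ge0 l (d2 0%N)) (d2e 0%N).
have d2X k : inX l (d2 k) by case: d2U.
have [[phi0 phiX] _ phiR phiJ _] := sol.
pose V s := normX l (phi s) ^+ 2.
pose J k := jump_map l delta alpha beta gamma (d2 k) (phi (tau k)).
pose W k := normX l (J k) ^+ 2.
have VE s : V s = H01norm l (phi s).1 ^+ 2 + `|(phi s).2| ^+ 2.
  by rewrite /V normX_sqr [in RHS]real_normK ?num_real.
have WE k : W k = H01norm l (J k).1 ^+ 2 + `|(J k).2| ^+ 2.
  by rewrite /W normX_sqr [in RHS]real_normK ?num_real.
have V_ge0 s : 0 <= V s := sqr_ge0 _.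
have JX k : t0 <= tau k -> ((tau k)%:E < T)%E -> inX l (J k).
  by move=> tk kT; apply: (jump_inX l_gt0 delta gamma alphaC2 betaH) => //; exact: phiX.
have tau_lt i j : tau i < tau j -> (i < j)%N.
  apply: contraTltn => ji; rewrite -leNgt.
  by apply: (@homo_leq _ tau <=%R) => // [x y z|n]; [exact: le_trans|exact/ltW/tauP.1].
have tau_gap k s : tau k < s -> s < tau k.+1 -> ~ range tau s.
  move=> ks sk [j _ js]; move: ks sk; rewrite -js => /tau_lt kj /tau_lt.
  by rewrite ltnS leqNgt kj.
have WJ k (ep m : R) : t0 <= tau k -> ((tau k)%:E < T)%E -> 0 < ep -> 0 <= m ->
    P * H01norm l (phi (tau k)).1 ^+ 2 + 2 * Q * H01norm l (phi (tau k)).1 * `|(phi (tau k)).2|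
      + r * `|(phi (tau k)).2| ^+ 2 <= m * V (tau k) ->
    W k <= (1 + ep) * (m * V (tau k)) + (1 + ep^-1) * e ^+ 2.
  move=> tk kT ep0 m0 f.
  have jb := jump_bound l_gt0 delta alphaC2 betaH gammaL (d2X k) (phiX _ tk kT).
  by apply: (jump_sqr_bound ep0 (normX_ge0 l _) (mulr_ge0 m0 (V_ge0 _)) jb f (d2e k)).
have segment s0 s1 xp := @solution_segment _ _ l_gt0 _ _ _ _ _ BH DL PhiC1.1 PhiC1.2
  dPhi_le0 Phi_sign _ _ _ _ _ _ _ _ s0 s1 xp e t00 d1U d1e sol.
suff VB : V t <= M * expR (- eta * t) * V t0 + N * e ^+ 2.
  apply: sqrt_gain_bound; rewrite ?normX_ge0 ?expR_ge0 ?(ltW M_gt0) ?(ltW N_gt0)//.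
  have -> : expR (- (eta / 2) * t) ^+ 2 = expR (- eta * t).
    by rewrite -expRM_natl; congr expR; field.
  by rewrite -phi0 mulrAC.
apply: (HB e T V W) => //.
- by move=> k; exact: sqr_ge0.
- move=> s ts sT noimp.
  have tau0 : ~ range tau t0 by move=> [k _ kt]; apply: (noimp k); rewrite kt lexx.
  have t0T : (t0%:E < T)%E by apply: lt_trans sT; rewrite lte_fin.
  have seg : dissipative_segment A b1 b2 C e t0 s (H01norm l (phi t0).1) `|(phi t0).2|
      (fun s => H01norm l (phi s).1) (fun s => `|(phi s).2|).
    apply: segment => //.
    + by move=> u tu us [k _ ku]; apply: (noimp k); rewrite ku us (ltW tu).
    + exact: phiX.
    + exact: phiR.
  by rewrite !VE; exact: (flow_growth lamA_ge0 lamP ts seg).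
- move=> k s tk ks sk sT.
  have kT : ((tau k)%:E < T)%E by apply: lt_trans sT; rewrite lte_fin.
  have seg : dissipative_segment A b1 b2 C e (tau k) s (H01norm l (J k).1) `|(J k).2|
      (fun s => H01norm l (phi s).1) (fun s => `|(phi s).2|).
    apply: segment => //.
    + by move=> u ku us; apply: (tau_gap k) => //; exact: lt_le_trans sk.
    + exact: JX.
    + exact: phiJ.
  by rewrite VE WE; exact: (flow_growth lamA_ge0 lamP ks seg).
- move=> k tk kT; have := WJ k 1 lamB tk kT ltr01 lamB_ge0.
  by rewrite VE invr1 => /(_ (Bform _ _)); lra.
move=> k tk kT.
have kS := tauP.1 k.
have kT' : ((tau k)%:E < T)%E by apply: lt_trans kT; rewrite lte_fin.
have tk' : t0 <= tau k.+1 := le_trans tk (ltW kS).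
have seg : dissipative_segment A b1 b2 C e (tau k) (tau k.+1) (H01norm l (J k).1) `|(J k).2|
    (fun s => H01norm l (phi s).1) (fun s => `|(phi s).2|).
  apply: segment => //.
  + by move=> u ku us; exact: (tau_gap k).
  + exact: JX.
  + exact: phiJ.
have /andP[dw1 dw2] := dwell k.
have W_ge0 : 0 <= W k := sqr_ge0 _.
have e2_ge0 : 0 <= e ^+ 2 := sqr_ge0 e.
have cC1 : 1 + eps^-1 <= C1.
  rewrite /C1 lerDr; apply: mulr_ge0; first by rewrite addr_ge0 ?(ltW eps_gt0).
  apply: mulr_ge0 => //; apply: mulr_ge0; first exact: expR_ge0.
  by rewrite addr_ge0//; exact: divr_ge0 (ler0n _ 8) (sqr_ge0 _).
have := flow_interval A_ge0 b1_ge0 b2_ge0 (ltW C_gt0) lamA_ge0 lamP kS seg eps_gt0 eps_kap.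
rewrite -VE -WE; case=> [Vb|[qp Vb]|[pq Vb]].
(* Here the cone reached at the impulse is unknown, so the jump is bounded by lambda_max(B_0). *)
- have := WJ k.+1 eps lamB tk' kT eps_gt0 lamB_ge0; rewrite {1}VE => /(_ (Bform _ _)) H.
  apply: (reset_step (ltW eps_gt0) lamB_ge0 _ e2_ge0 _ Vb _ H).
  + by rewrite addr_ge0//; exact: divr_ge0 (ler0n _ 8) (sqr_ge0 _).
  + by rewrite mulr_ge0 // ltW; case/andP: kap01.
  + by rewrite ler_expR; exact: ler_wpM2l.
- have := WJ k.+1 eps m1 tk' kT eps_gt0 m1_ge0.
  rewrite {1}VE => /(_ (form1 _ _ (normr_ge0 _) (ltW qp))) H.
  apply: (gain_step (ltW eps_gt0) m1_ge0 W_ge0 e2_ge0 Vb _ G1 H cC1).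
  (* As eps - vartheta < 0, the shortest dwell time theta1 is the worst case; in the growing case
     below it is theta2. *)
  by rewrite ler_expR; apply: ler_wnM2l => //; rewrite subr_le0 ltW.
have := WJ k.+1 eps m2 tk' kT eps_gt0 m2_ge0.
rewrite {1}VE => /(_ (form2 _ _ (H01norm_ge0 _ _) pq)) H.
apply: (gain_step (ltW eps_gt0) m2_ge0 W_ge0 e2_ge0 Vb _ G2 H cC1).
by rewrite ler_expR; apply: ler_wpM2l => //; rewrite addr_ge0 ?(ltW eps_gt0).
Qed.
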